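(* Let $U:\mathbb{R}\to(-\infty,\infty]$ be measurable with $U(x)=U(-x)$, $\inf_x U(x)>-\infty$, $0<\int e^{-U(x)}dx<\infty$, and suppose that either $U(x)<\infty$ for all $x$, or there is $0<K<\infty$ with $U(x)<\infty$ for $|x|<K$ and $U(x)=\infty$ for $|x|>K$. Then for every $0<\delta<1$ there exists $0<L<\infty$ such that for all $n\ge1$, $U$ has $(\delta,L)$-controlled gradients on $\mathbb{T}_n^2$.
   Context: For $n\ge1$, $\mathbb{T}_n^2$ is the discrete torus with vertex set $V(\mathbb{T}_n^2)=\{-n+1,\dots,n\}^2$, where $(a,b)$ and $(c,d)$ are adjacent if they agree in one coordinate and differ by exactly $1$ modulo $2n$ in the other; $E(\mathbb{T}_n^2)$ is its edge set and $\mathbf 0=(0,0)$. $\mu_{\mathbb{T}_n^2,\mathbf 0,U}$ is the probability measure on $\varphi:V(\mathbb{T}_n^2)\to\mathbb{R}$ with density $Z^{-1}\exp(-\sum_{(v,w)\in E(\mathbb{T}_n^2)}U(\varphi_v-\varphi_w))$ with respect to $\delta_0(d\varphi_{\mathbf 0})\prod_{v\ne\mathbf 0}d\varphi_v$. For $0<L<\infty$ and $0<\delta<1$, $U$ has $(\delta,L)$-controlled gradients on $\mathbb{T}_n^2$ if: (1) there is $K>L$ with $U(x)<\infty$ for $|x|<K$; and (2) if $\varphi\sim\mu_{\mathbb{T}_n^2,\mathbf 0,U}$ and $\mathcal{E}(\varphi,L):=\{(v,w)\in E(\mathbb{T}_n^2):|\varphi_v-\varphi_w|\ge L\}$, then $\mathbb{P}(e_1,\dots,e_k\in\mathcal{E}(\varphi,L))\le\delta^k$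 for all $k\ge1$ and all distinct $e_1,\dots,e_k\in E(\mathbb{T}_n^2)$. *)

(* Defs.v *)
From HB Require Import structures.
From mathcomp Require Import all_boot all_order all_algebra.
From mathcomp Require Import all_classical all_reals all_analysis.
From mathcomp Require Import measurable_realfun.
Set Implicit Arguments. Unset Strict Implicit. Unset Printing Implicit Defensive.
Import Order.TTheory GRing.Theory Num.Theory.
Import numFieldNormedType.Exports.
Local Open Scope classical_set_scope.
Local Open Scope ring_scope.

(* Vertices of T_n^2: pairs (i, j) of ordinals < 2n; the ordinal i stands for
   the coordinate i - n + 1 in {-n+1, ..., n}. *)
Definition tvert (n : nat) : finType := ('I_(n.*2) * 'I_(n.*2))%type.

Lemma torigin_lt (n : nat) (hn : (0 < n)%N) : (n.-1 < n.*2)%N.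
Proof. by rewrite -addnn; case: n hn => // n _; rewrite /= addSn ltnS leq_addr. Qed.

Definition torigin (n : nat) (hn : (0 < n)%N) : tvert n :=
  (Ordinal (torigin_lt hn), Ordinal (torigin_lt hn)).

Definition diff1 (n : nat) (i j : 'I_(n.*2)) : bool :=
  ((i.+1 %% n.*2)%N == j) || ((j.+1 %% n.*2)%N == i).

Definition tadj (n : nat) (v w : tvert n) : bool :=
  ((v.1 == w.1) && diff1 v.2 w.2) || ((v.2 == w.2) && diff1 v.1 w.1).

(* E(T_n^2): each (unordered) edge {v,w} is represented once, by the ordered
   pair (v,w) with enum_rank v < enum_rank w. *)
Definition tedges (n : nat) : {set tvert n * tvert n} :=
  [set p | tadj p.1 p.2 && (enum_rank p.1 < enum_rank p.2)%N].

Section Gibbs.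
Variable R : realType.
Local Open Scope ereal_scope.

Definition upd (n : nat) (phi : tvert n -> R) (v : tvert n) (x : R) : tvert n -> R :=
  fun w => if w == v then x else phi w.

(* iterated Lebesgue integral over the coordinates listed in s (for
   nonnegative integrands this is the integral against the product Lebesgue
   measure, by Tonelli) *)
Fixpoint iint (n : nat) (s : seq (tvert n)) (f : (tvert n -> R) -> \bar R)
    (phi : tvert n -> R) : \bar R :=
  match s with
  | [::] => f phi
  | v :: s' => \int[@lebesgue_measure R]_(x in setT) iint s' f (upd phi v x)
  end.

(* integral of f against  delta_0(d phi_0) prod_{v <> 0} d phi_v *)
Definition pinned_int (n : nat) (hn : (0 < n)%N) (f : (tvert n -> R) -> \bar R) : \bar R :=
  iint (enum [set v : tvert n | v != torigin hn]) f (fun _ => 0%R).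

Definition gibbs_dens (n : nat) (U : R -> \bar R) (phi : tvert n -> R) : \bar R :=
  expeR (- \sum_(e in tedges n) U (phi e.1 - phi e.2)%R).

Definition gibbs_Z (n : nat) (hn : (0 < n)%N) (U : R -> \bar R) : \bar R :=
  pinned_int hn (gibbs_dens U).

Definition gibbs_prob (n : nat) (hn : (0 < n)%N) (U : R -> \bar R)
    (A : (tvert n -> R) -> bool) : R :=
  (fine (pinned_int hn (fun phi => ((if A phi then 1%R else 0%R)%:E * gibbs_dens U phi)%E))
   / fine (gibbs_Z hn U))%R.

(* U has (delta, L)-controlled gradients on T_n^2.  The first conjunct says
   that the measure mu_{T_n^2,0,U} is well defined (0 < Z < oo). *)
Definition controlled_gradients (n : nat) (hn : (0 < n)%N) (U : R -> \bar R)
    (delta L : R) : Prop :=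
  (0 < gibbs_Z hn U < +oo) /\
  (exists K : R, (L < K)%R /\ forall x : R, (`|x| < K)%R -> U x < +oo) /\
  (forall S : {set tvert n * tvert n}, S \subset tedges n -> S != finset.set0 ->
     (gibbs_prob hn U
        (fun phi => [forall e in S, (L <= `|phi e.1 - phi e.2|)%R])
      <= delta ^+ #|S|)%R).

End Gibbs.

(* Main.v *)
Require Import Defs.
From HB Require Import structures.
From mathcomp Require Import all_boot all_order all_algebra.
From mathcomp Require Import all_classical all_reals all_analysis.
From mathcomp Require Import measurable_realfun.
From mathcomp Require Import ring lra zify.
Import Order.TTheory GRing.Theory Num.Theory.
Import numFieldNormedType.Exports.
Local Open Scope classical_set_scope.
Local Open Scope ring_scope.
Set Implicit Arguments.
Unset Strict Implicit.
Unset Printing Implicit Defensive.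

(** The proof is a chessboard (Peierls) argument based on reflections through
    vertices, which are available for every measurable potential.  Write
    [e^-U = r^2] and let [N S] be the partition function in which every
    directed edge carries the weight [r], multiplied by
    [delta^-1 1_{|.| >= L}] on the directed edges of [S]; the claim is
    [N S <= N 0].  A line of vertices and its antipode cut the torus into two
    mirror halves that are conditionally independent given the cut, so
    [2 x y <= x^2 + y^2] yields [2 N S <= N S' + N S''], where [S'] and [S'']
    are obtained from [S] by reflecting one half onto the other.  Since the
    factors [delta^-1] are part of the weight, the two reflections of a
    maximizer of [N] are again maximizers.  Starting from one edge, repeated
    reflections produce a maximizer containing all edges of every other row
    (or column).  For such a set, integrating along a spanning tree bounds [N]
    by [C^(n^2) eta^(n^2)], with [eta] the integral of [e^-U] over
    [|x| >= L], whereas sequentially confining the heights to a small window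
    gives [N 0 >= c^(n^2)].  Hence [eta] small enough makes the empty set
    a maximizer.  *)

(** * Iterated Lebesgue integrals *)

Section LebesgueInvariance.
Context {R : realType}.
Local Notation mu := (@lebesgue_measure R).

Let pushforward_fun (h : R -> R) (mh : measurable_fun setT h)
  (muh : forall a b : R, mu (h @^-1` `]a, b]%classic) = mu `]a, b]%classic)
  (f : R -> \bar R) : measurable_fun setT f -> (forall x, (0 <= f x)%E) ->
  (\int[mu]_(x in setT) f (h x) = \int[mu]_(x in setT) f x)%E.
Proof.
move=> mf f0.
pose mh' := isMeasurableFun.Build _ _ (measurableTypeR R) (measurableTypeR R) h mh.
pose ph : {mfun measurableTypeR R >-> measurableTypeR R} := HB.pack h mh'.
rewrite -[LHS](@ge0_integral_pushforward _ _ (measurableTypeR R) (measurableTypeR R)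
   R h mh mu setT f) //.
apply: (eq_measure_integral mu) => A mA _.
apply/esym; apply: (@lebesgue_measure_unique R (pushforward mu ph)) => //.
move=> X /ocitvP[->|[x xle ->]]; last exact/esym/muh.
by change (mu set0 = mu (h @^-1` set0)); rewrite preimage_set0.
Qed.

Lemma ge0_integral_translate (c : R) (f : R -> \bar R) :
  measurable_fun setT f -> (forall x, (0 <= f x)%E) ->
  (\int[mu]_(x in setT) f (x + c)%R = \int[mu]_(x in setT) f x)%E.
Proof.
move=> mf f0; apply: (pushforward_fun (h := fun x => x + c)) => //.
  exact: measurable_funD.
move=> a b.
have -> : (fun x : R => x + c) @^-1` `]a, b]%classic = `]a - c, b - c]%classic.
  by apply/seteqP; split=> x /=; rewrite !in_itv/= ltrBlDr lerBrDr.
by rewrite !lebesgue_measure_itv/= !lte_fin ltrD2r; case: ifP => // _; congr EFin; ring.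
Qed.

Lemma ge0_integral_opp (f : R -> \bar R) :
  measurable_fun setT f -> (forall x, (0 <= f x)%E) ->
  (\int[mu]_(x in setT) f (- x)%R = \int[mu]_(x in setT) f x)%E.
Proof.
move=> mf f0; apply: (pushforward_fun (h := fun x => - x)) => //.
  exact: measurable_funN.
move=> a b.
have -> : (fun x : R => - x) @^-1` `]a, b]%classic = `[- b, - a[%classic.
  by apply/seteqP; split=> x /=; rewrite !in_itv/= ltrNr lerNl andbC.
by rewrite !lebesgue_measure_itv/= !lte_fin ltrN2; case: ifP => // _; congr EFin; ring.
Qed.

End LebesgueInvariance.

Section IteratedIntegral.
Context {R : realType} {n : nat}.
Local Open Scope ereal_scope.
Local Notation V := (tvert n).
Local Notation mu := (@lebesgue_measure R).
Implicit Types (f g : (V -> R) -> \bar R) (phi psi : V -> R) (s : seq V).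

(* Joint measurability is tested against all measurable parametrizations, so
   that no sigma-algebra on [V -> R] has to be fixed. *)
Definition cmeas d (T' : measurableType d) (f : (V -> R) -> T') : Prop :=
  forall d (T : measurableType d) (g : T -> V -> R),
    (forall v, measurable_fun setT (g ^~ v)) -> measurable_fun setT (f \o g).

Lemma updE phi v x w : upd phi v x w = if w == v then x else phi w.
Proof. by []. Qed.

Lemma updC phi v w x y : v != w ->
  upd (upd phi v x) w y = upd (upd phi w y) v x.
Proof.
move=> vw; apply/funext => z; rewrite !updE.
by case: (eqVneq z w) => // ->; rewrite eq_sym (negbTE vw).
Qed.

Lemma measurable_upd d (T : measurableType d) (g : T -> V -> R) v (x : T -> R) :
  (forall w, measurable_fun setT (g ^~ w)) -> measurable_fun setT x ->
  forall w, measurable_fun setT (fun t => upd (g t) v (x t) w).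
Proof.
move=> mg mx w; rewrite /upd; case: (w == v) => //.
Qed.

Lemma iint_ge0 s f phi : (forall psi, 0 <= f psi) -> 0 <= iint s f phi.
Proof.
move=> f0; elim: s phi => [|v s IH] phi //=.
by apply: integral_ge0 => x _.
Qed.

(** Testing against every parameter space lets the induction adjoin the integration variable to the
    parameters; Tonelli then integrates it out. *)
Lemma cmeas_iint s f : (forall psi, 0 <= f psi) -> cmeas f -> cmeas (iint s f).
Proof.
move=> f0 mf; elim: s => [//|v s IH] d T g mg /=.
pose F (z : T * measurableTypeR R) := iint s f (upd (g z.1) v z.2).
apply: (@measurable_fun_fubini_tonelli_F _ _ _ _ R mu F) => //=.
  apply: (IH _ _ (fun z : T * measurableTypeR R => upd (g z.1) v z.2)).
  apply: measurable_upd => // w.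
  exact: (measurableT_comp (mg w)).
by move=> z; exact: iint_ge0.
Qed.

Lemma measurable_iint_upd s f phi v :
  (forall psi, 0 <= f psi) -> cmeas f ->
  measurable_fun setT (fun x : R => iint s f (upd phi v x)).
Proof.
move=> f0 mf; apply: (cmeas_iint s f0 mf (g := fun x : R => upd phi v x)).
by apply: measurable_upd.
Qed.

Lemma iint_le s f g phi : (forall psi, 0 <= f psi) -> cmeas f -> cmeas g ->
  (forall psi, f psi <= g psi) -> iint s f phi <= iint s g phi.
Proof.
move=> f0 mf mg fg; have g0 psi : 0 <= g psi by apply: le_trans (fg psi).
elim: s phi => [//|v s IH] phi /=.
apply: ge0_le_integral => //; try exact: measurable_iint_upd.
by move=> x _; exact: iint_ge0.
Qed.

Lemma eq_iint s f g phi : (forall psi, f psi = g psi) ->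
  iint s f phi = iint s g phi.
Proof.
move=> fg; elim: s phi => [//|v s IH] phi /=.
by apply: eq_integral => x _.
Qed.

Lemma iint_cat s1 s2 f phi : iint (s1 ++ s2) f phi = iint s1 (iint s2 f) phi.
Proof.
elim: s1 phi => [//|v s IH] phi /=.
by apply: eq_integral => x _.
Qed.

Lemma iintD s f g phi : (forall psi, 0 <= f psi) -> (forall psi, 0 <= g psi) ->
  cmeas f -> cmeas g ->
  iint s (fun psi => f psi + g psi) phi = iint s f phi + iint s g phi.
Proof.
move=> f0 g0 mf mg; elim: s phi => [//|v s IH] phi /=.
rewrite -ge0_integralD //; try exact: measurable_iint_upd.
- by apply: eq_integral => x _.
- by move=> x _; exact: iint_ge0.
- by move=> x _; exact: iint_ge0.
Qed.

Definition indep s d (T : measurableType d) (c : (V -> R) -> T) :=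
  forall phi psi, (forall w, w \notin s -> phi w = psi w) -> c phi = c psi.

Lemma iintZ s c f phi : (forall psi, 0 <= f psi) -> (forall psi, 0 <= c psi) ->
  cmeas f -> indep s c ->
  iint s (fun psi => c psi * f psi) phi = c phi * iint s f phi.
Proof.
move=> f0 c0 mf; elim: s phi => [//|v s IH] phi ic /=.
rewrite -ge0_integralZl //; try exact: measurable_iint_upd.
- apply: eq_integral => x _; rewrite IH.
    congr (_ * _); apply: ic => w; rewrite inE negb_or updE.
    by case: eqP.
  move=> psi psi' E; apply: ic => w; rewrite inE negb_or => /andP[_].
  exact: E.
- by move=> x _; exact: iint_ge0.
Qed.

(** Coordinates in [s] are overwritten by the integration, so only those of [s1] outside [s] have to
    be tested on the integrand. *)
Lemma indep_iint s1 s f :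
  indep [seq v <- s1 | v \notin s] f -> indep s1 (iint s f).
Proof.
elim: s s1 f => [|v s IH] s1 f ind /=.
  by move: ind; rewrite (_ : [seq _ <- _ | _] = s1) //; apply/all_filterP/allP.
move=> phi psi E /=; apply: eq_integral => x _.
(* Once [v] is updated both configurations agree there, so [v] leaves the list of coordinates that
   may differ. *)
apply: (IH [seq w <- s1 | w != v]).
  rewrite -filter_predI; move=> phi' psi' E'; apply: ind => w Hw; apply: E'.
  by apply: contra Hw; rewrite !mem_filter /= in_cons negb_or [(w != v) && _]andbC.
move=> w; rewrite mem_filter negb_and negbK !updE; case: (w == v) => //=.
exact: E.
Qed.

Lemma iint_swap v w s f phi : (forall psi, 0 <= f psi) -> cmeas f ->
  iint (v :: w :: s) f phi = iint (w :: v :: s) f phi.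
Proof.
move=> f0 mf; have [->//|vw] := eqVneq v w => /=.
under [RHS]eq_integral do under eq_integral do rewrite -updC//.
pose F (z : measurableTypeR R * measurableTypeR R) :=
  iint s f (upd (upd phi v z.1) w z.2).
apply: (@fubini_tonelli _ _ _ _ R mu mu F).
  apply: (cmeas_iint s f0 mf (g := fun z : measurableTypeR R * measurableTypeR R =>
    upd (upd phi v z.1) w z.2)).
  apply: measurable_upd => //.
  by apply: measurable_upd.
by move=> z; exact: iint_ge0.
Qed.

Lemma iint_perm s s' f phi : (forall psi, 0 <= f psi) -> cmeas f ->
  perm_eq s s' -> iint s f phi = iint s' f phi.
Proof.
move=> f0 mf; move: s' phi; elim: s => [|v s IH] s' phi ss'.
  by move: ss'; rewrite perm_sym => /perm_nilP ->.
have vs' : v \in s' by rewrite -(perm_mem ss') mem_head.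
have [s1 [s2 E]] : exists s1 s2, s' = s1 ++ v :: s2.
  by case/splitPr: vs' => s1 s2; exists s1, s2.
subst s'; have {}ss' : perm_eq s (s1 ++ s2).
  by rewrite -(perm_cons v) (perm_trans ss') // -cat1s perm_catCA.
rewrite (_ : iint (v :: s) f phi = iint (v :: s1 ++ s2) f phi); last first.
  by apply: eq_integral => x _; exact: IH.
elim: s1 phi {ss' vs'} => [//|w s1 IH1] phi.
rewrite iint_swap //= -/(iint _ _ _).
by apply: eq_integral => x _; exact: IH1.
Qed.

(** This is a renaming of the coordinates and not a change of variables: updating at [v] and then
    composing with [theta] is updating at [theta v]. *)
Lemma iint_reindex (theta : V -> V) s f phi : involutive theta ->
  iint s (fun psi => f (psi \o theta)) phi =
  iint (map theta s) f (phi \o theta).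
Proof.
move=> inv; elim: s phi => [//|v s IH] phi /=.
apply: eq_integral => x _; rewrite IH; congr (iint _ _ _).
by apply/funext => w /=; rewrite !updE -(inj_eq (inv_inj inv)) inv.
Qed.

Lemma iint_shift s f phi (c : R) : (forall psi, 0 <= f psi) -> cmeas f ->
  (forall psi, f (fun v => psi v + c)%R = f psi) ->
  iint s f (fun v => phi v + c)%R = iint s f phi.
Proof.
move=> f0 mf fc; elim: s phi => [//|v s IH] phi /=.
rewrite -(ge0_integral_translate c) //=; last 2 first.
- exact: measurable_iint_upd.
- by move=> x; exact: iint_ge0.
apply: eq_integral => x _; rewrite -[RHS]IH; congr (iint _ _ _).
by apply/funext => w; rewrite !updE; case: ifP.
Qed.

Definition others (v0 : V) : seq V := enum [set v | v != v0]%classic.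

Lemma mem_others v0 v : (v \in others v0) = (v != v0).
Proof. by rewrite mem_enum /in_mem /= /in_set asboolb. Qed.

Lemma others_uniq v0 : uniq (others v0).
Proof. exact: enum_uniq. Qed.

(* Shifting all heights moves the pin; the reflection argument needs the pin
   on the reflection line. *)
Lemma iint_repin (v0 v1 : V) f : (forall psi, 0 <= f psi) -> cmeas f ->
  (forall psi c, f (fun v => psi v + c)%R = f psi) ->
  iint (others v0) f (fun=> 0%R) = iint (others v1) f (fun=> 0%R).
Proof.
move=> f0 mf fc; have [->//|v01] := eqVneq v0 v1.
pose s := [seq v <- others v0 | v != v1].
have Hs v : (v \in s) = (v != v0) && (v != v1).
  by rewrite mem_filter mem_others andbC.
have us : uniq s by rewrite filter_uniq ?others_uniq.
have p0 : perm_eq (others v0) (v1 :: s).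
  apply: uniq_perm; rewrite ?cons_uniq ?others_uniq ?Hs ?eqxx ?andbF ?us //.
  move=> v; rewrite mem_others in_cons Hs.
  by case: (eqVneq v v1) => [->|] /=; rewrite ?andbT // eq_sym.
have p1 : perm_eq (others v1) (v0 :: s).
  apply: uniq_perm; rewrite ?cons_uniq ?others_uniq ?Hs ?eqxx ?andbF ?us //.
  move=> v; rewrite mem_others in_cons Hs.
  by case: (eqVneq v v0) => [->|] /=.
rewrite (iint_perm _ f0 mf p0) (iint_perm _ f0 mf p1).
(* The heights 0 at [v0] and [- x] at [v1] are the heights [x] and 0 shifted by [- x], hence the
   change of sign before the shift. *)
rewrite /= -(ge0_integral_opp) /=; last 2 first.
- exact: measurable_iint_upd.
- by move=> x; exact: iint_ge0.
apply: eq_integral => x _.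
rewrite -[RHS](iint_shift s _ (c := (- x)%R)) //.
apply: (indep_iint (s1 := s)) => [phi psi E|w].
  by congr f; apply/funext => w; apply: E; apply/negP; rewrite mem_filter => /andP[] /negP.
rewrite Hs negb_and !negbK !updE => /orP[] /eqP ->.
  by rewrite (negbTE v01) eqxx subrr.
by rewrite eqxx eq_sym (negbTE v01) add0r.
Qed.

End IteratedIntegral.

(** * Reflection positivity *)

Section Weights.
Context {R : realType} {n : nat}.
Local Notation V := (tvert n).
Variable k : bool -> R -> R.
Hypothesis mk : forall b, measurable_fun setT (k b).
Hypothesis k0 : forall b x, 0 <= k b x.
Implicit Types (P E S : pred (V * V)) (phi psi : V -> R).

Definition weight P S phi : R := \prod_(e | P e) k (S e) (phi e.1 - phi e.2).

Lemma weight_ge0 P S phi : 0 <= weight P S phi.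
Proof. by apply: prodr_ge0 => e _. Qed.

Lemma cmeas_weight P S : cmeas (EFin \o weight P S).
Proof.
move=> d T g mg; apply/measurable_EFinP; rewrite /weight.
under [X in measurable_fun _ X]eq_fun do rewrite big_mkcond.
apply: measurable_prod => e _; case: (P e) => //.
apply: (measurableT_comp (mk _)).
by apply: measurable_funB; exact: mg.
Qed.

Lemma weight_shift P S phi (c : R) :
  weight P S (fun v => phi v + c) = weight P S phi.
Proof.
by apply: eq_bigr => e _; congr (k _ _); rewrite opprD addrACA subrr addr0.
Qed.

Lemma eq_weight P S S' phi : (forall e, P e -> S e = S' e) ->
  weight P S phi = weight P S' phi.
Proof. by move=> SS'; apply: eq_bigr => e Pe; rewrite SS'. Qed.

Definition edge_map (theta : V -> V) (e : V * V) := (theta e.1, theta e.2).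

Lemma weight_reindex theta P S phi : involutive theta ->
  weight P S (phi \o theta) =
  weight (P \o edge_map theta) (S \o edge_map theta) phi.
Proof.
move=> inv; rewrite /weight (reindex_inj (h := edge_map theta)) /=.
  by apply: eq_bigr => e _; rewrite !inv.
by move=> [a b] [c d] [/(inv_inj inv) -> /(inv_inj inv) ->].
Qed.

Lemma indep_weight P S (s : seq V) :
  (forall e, P e -> (e.1 \notin s) && (e.2 \notin s)) ->
  indep s (EFin \o weight P S).
Proof.
move=> Ps phi psi E /=; congr EFin; apply: eq_bigr => e /Ps /andP[e1 e2].
by rewrite !E.
Qed.

Definition pf (E : pred (V * V)) v0 S : \bar R :=
  iint (others v0) (EFin \o weight E S) (fun=> 0).

Lemma pf_ge0 E v0 S : (0 <= pf E v0 S)%E.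
Proof. by apply: iint_ge0 => psi; rewrite lee_fin weight_ge0. Qed.

Lemma eq_pf E v0 S S' : (forall e, E e -> S e = S' e) -> pf E v0 S = pf E v0 S'.
Proof. by move=> SS'; apply: eq_iint => psi /=; rewrite (eq_weight _ SS'). Qed.

Lemma pf_repin E v0 v1 S : pf E v0 S = pf E v1 S.
Proof.
apply: iint_repin => [psi||psi c] /=; first by rewrite lee_fin weight_ge0.
  exact: cmeas_weight.
by rewrite weight_shift.
Qed.

(** Extended reals are required because the half-torus integrals are not known to be finite for
    fixed heights on the cut. *)
Lemma mule_AMGM (x y : \bar R) : (0 <= x -> 0 <= y ->
  x * y + x * y <= x * x + y * y)%E.
Proof.
case: x y => [x||] [y||] // x0 y0; rewrite -?EFinM -?EFinD ?lee_fin.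
- by have := sqr_ge0 (x - y); nra.
- by rewrite mulyy addey ?leey // -EFinM.
- by rewrite mulyy addye ?leey // -EFinM.
Qed.

Lemma cmeas_mule (f g : (V -> R) -> \bar R) : cmeas f -> cmeas g ->
  cmeas (fun phi => f phi * g phi)%E.
Proof.
by move=> mf mg d T h mh; apply: emeasurable_funM; [exact: mf|exact: mg].
Qed.

(** * Abstract reflections: [A] is an open half, its image under [theta] the other, and the
    remaining vertices form the fixed cut *)

Section Reflection.
Variables (E : pred (V * V)) (v0 : V) (A : pred V) (theta : V -> V).
Hypothesis invt : involutive theta.
Hypothesis Et : forall e, E (edge_map theta e) = E e.
Hypothesis AB : forall v, A v -> ~~ A (theta v).
Hypothesis sep : forall e, E e -> A e.1 || A e.2 ->
  ~~ (A (theta e.1) || A (theta e.2)).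
Hypothesis fixt : forall v, ~~ A v -> ~~ A (theta v) -> theta v = v.
Hypothesis v0A : ~~ A v0.
Hypothesis v0B : theta v0 = v0.

Let t := edge_map theta.
Let tt : involutive t. Proof. by move=> [a b]; rewrite /t /edge_map /= !invt. Qed.
Let tA (e : V * V) := A e.1 || A e.2.
Let tB e := tA (t e).
Let EA e := E e && tA e.
Let EB e := E e && tB e.
Let EC e := [&& E e, ~~ tA e & ~~ tB e].
Let sA := [seq v <- others v0 | A v].
Let sB := map theta sA.
Let sC := [seq v <- others v0 | ~~ A v && ~~ A (theta v)].

Let mem_sA v : (v \in sA) = A v.
Proof.
rewrite mem_filter mem_others; case Av: (A v) => //=.
by apply: contraL Av => /eqP ->.
Qed.

Let mem_sB v : (v \in sB) = A (theta v).
Proof. by rewrite -[v in LHS]invt mem_map ?mem_sA //; exact: inv_inj. Qed.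

Let mem_sC v : (v \in sC) = [&& ~~ A v, ~~ A (theta v) & v != v0].
Proof. by rewrite mem_filter mem_others -andbA. Qed.

Let perm_others : perm_eq (others v0) (sC ++ sA ++ sB).
Proof.
have uA : uniq sA by rewrite filter_uniq ?others_uniq.
apply: uniq_perm; first exact: others_uniq.
  rewrite !cat_uniq uA (map_inj_uniq (inv_inj invt)) uA.
  rewrite filter_uniq ?others_uniq //= andbT; apply/andP; split.
    apply/hasPn => v; rewrite mem_cat mem_sA mem_sB mem_sC.
    by case: (A v); case: (A (theta v)).
  apply/hasPn => v; rewrite mem_sA mem_sB => /AB.
  by rewrite invt.
move=> v; rewrite !mem_cat mem_sA mem_sB mem_sC mem_others.
have [->|_] := eqVneq v v0; first by rewrite v0B (negbTE v0A).
by rewrite andbT; case: (A v); case: (A (theta v)).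
Qed.

(** The partition function of the half [A], as a function of the heights on the cut. *)
Let X S phi : \bar R := iint sA (EFin \o weight EA S) phi.

Let w0 P S psi : (0 <= (EFin \o weight P S) psi)%E.
Proof. by rewrite lee_fin weight_ge0. Qed.

Let X0 S phi : (0 <= X S phi)%E. Proof. exact: iint_ge0. Qed.

Let mX S : cmeas (X S).
Proof. by apply: cmeas_iint => //; exact: cmeas_weight. Qed.

(** Reflecting the mirror half onto [A] turns its partition function into [X] for the reflected
    marks; the heights on the cut do not change. *)
Let XB S phi : iint sB (EFin \o weight EB S) phi = X (S \o t) phi.
Proof.
have -> : phi = (phi \o theta) \o theta by apply/funext => v /=; rewrite invt.
rewrite -(iint_reindex _ _ _ invt).
transitivity (X (S \o t) (phi \o theta)).
  apply: eq_iint => psi /=; rewrite weight_reindex //; congr EFin.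
  apply: eq_bigl => e; rewrite /EA /EB /tB /= -/t tt.
  by rewrite /t Et.
(* An edge that meets [A] has no end in the mirror half, so [X] depends on the cut alone, where
   [phi] and [phi \o theta] agree. *)
apply: (indep_iint (s1 := sA ++ sB)).
  apply: indep_weight => e /andP[Ee tAe].
  have := sep Ee tAe; rewrite negb_or => /andP[B1 B2].
  have H v : ~~ A (theta v) -> v \notin [seq w <- sA ++ sB | w \notin sA].
    move=> Bv; apply/negP; rewrite mem_filter => /andP[/negbTE v1].
    by rewrite mem_cat v1 mem_sB (negbTE Bv).
  by rewrite !H.
move=> v; rewrite mem_cat mem_sA mem_sB negb_or => /andP[Av Bv] /=.
by rewrite !(fixt Av Bv).
Qed.

(** Conditional independence given the cut: no edge meets both open halves, so the weight splits
    into [EA], [EB] and [EC], and each half is integrated separately. *)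
Lemma pf_factor S : pf E v0 S =
  iint sC (fun phi => ((weight EC S phi)%:E * (X S phi * X (S \o t) phi))%E)
    (fun=> 0).
Proof.
rewrite /pf (iint_perm _ (w0 E S) (@cmeas_weight E S) perm_others).
rewrite iint_cat; apply: eq_iint => phi.
rewrite iint_cat.
transitivity (iint sA (fun psi => ((weight EC S psi)%:E * X (S \o t) psi) *
    (weight EA S psi)%:E)%E phi); last first.
  rewrite iintZ //.
  - by rewrite -/(X S phi) -muleA; congr (_ * _)%E; rewrite muleC.
  - by move=> psi; exact: w0.
  - by move=> psi; rewrite mule_ge0 //; exact: w0.
  - exact: cmeas_weight.
  move=> f g fg; congr (_ * _)%E.
    apply: indep_weight fg => e /and3P[_].
    by rewrite /tA !mem_sA -negb_or.
  apply: (indep_iint (s1 := sA)) => // f' g' fg'.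
  congr ((EFin \o weight EA (S \o t)) _); apply/funext => v; apply: fg'.
  by apply/negP; rewrite mem_filter => /andP[/negP].
apply: eq_iint => psi.
rewrite -XB muleAC -EFinM.
rewrite -(iintZ (c := fun f => (weight EC S f * weight EA S f)%:E)) //.
- apply: eq_iint => f /=; rewrite -EFinM /weight; congr EFin.
  (* Edges meeting [A] are set aside first; the others are sorted by whether they meet the mirror
     half. *)
  rewrite (bigID tA) /= mulrC
    [in X in _ = _ * _ * X](eq_bigl (fun e => E e && ~~ tA e && tB e)).
    rewrite -mulrA [RHS]mulrCA mulrC; congr (_ * _).
    rewrite [LHS](bigID tB) /= mulrC; congr (_ * _).
    by apply: eq_bigl => e; rewrite /EC andbA.
  move=> e; rewrite /EB -andbA; case Ee : (E e) => //=.
  case tAe : (tA e) => //=; apply/negbTE; exact: (sep Ee tAe).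
- by move=> f; rewrite lee_fin mulr_ge0 ?weight_ge0.
- exact: cmeas_weight.
move=> f g fg; rewrite !EFinM; congr (_ * _)%E; apply: indep_weight fg => e.
  by move=> /and3P[_ _]; rewrite /tB /tA !mem_sB -negb_or.
by move=> /andP[Ee tAe]; rewrite !mem_sB -negb_or; exact: (sep Ee tAe).
Qed.

(** [reflectA] copies the marks of the half [A] onto the mirror half, [reflectB] does the reverse;
    edges within the cut keep their marks. *)
Definition reflectA S : pred (V * V) := fun e => if tB e then S (t e) else S e.
Definition reflectB S : pred (V * V) := fun e => if tA e then S (t e) else S e.

(** By [pf_factor] the three sets give the integrands [X S * X (S \o t)], [X S * X S] and
    [X (S \o t) * X (S \o t)] with the same cut weight, so [mule_AMGM] applies pointwise. *)
Lemma pf_reflection S :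
  (pf E v0 S + pf E v0 S <= pf E v0 (reflectA S) + pf E v0 (reflectB S))%E.
Proof.
have tAt e : tA (t e) = tB e by [].
have tBt e : tB (t e) = tA e by rewrite /tB tt.
have notB e : E e -> tA e -> tB e = false.
  by move=> Ee tAe; apply/negbTE; exact: (sep Ee tAe).
have XA S1 S2 phi : (forall e, E e -> tA e -> S1 e = S2 e) -> X S1 phi = X S2 phi.
  move=> S12; apply: eq_iint => psi /=; rewrite (@eq_weight _ _ S2) //.
  by move=> e /andP[]; exact: S12.
have WC S1 phi : (forall e, E e -> tA e = false -> tB e = false -> S1 e = S e) ->
    weight EC S1 phi = weight EC S phi.
  by move=> S1S; apply: eq_weight => e /and3P[? /negbTE ? /negbTE ?]; exact: S1S.
rewrite !pf_factor.
pose F x y (phi : V -> R) : \bar R :=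
  ((weight EC S phi)%:E * (X x phi * X y phi))%E.
have F0 x y phi : (0 <= F x y phi)%E.
  by rewrite mule_ge0 ?mule_ge0 // lee_fin weight_ge0.
have mF x y : cmeas (F x y).
  by apply: cmeas_mule; [exact: cmeas_weight|exact: cmeas_mule].
rewrite [X in (_ <= X + _)%E](_ : _ = iint sC (F S S) (fun=> 0)); last first.
  apply: eq_iint => phi; rewrite WC; last by move=> e _ _ tBe; rewrite /reflectA tBe.
  congr (_ * (_ * _))%E; apply: XA => e Ee tAe; rewrite /reflectA /=.
    by rewrite notB.
  by rewrite tBt tAe tt.
rewrite [X in (_ <= _ + X)%E](_ : _ = iint sC (F (S \o t) (S \o t)) (fun=> 0)); last first.
  apply: eq_iint => phi; rewrite WC; last by move=> e _ tAe _; rewrite /reflectB tAe.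
  congr (_ * (_ * _))%E; apply: XA => e Ee tAe; rewrite /reflectB /=.
    by rewrite tAe.
  by rewrite tAt notB.
rewrite -/(F S (S \o t)) -!iintD //; apply: iint_le => [phi|||phi].
- by rewrite adde_ge0.
- by move=> d T g mg; apply: emeasurable_funD; exact: mF.
- by move=> d T g mg; apply: emeasurable_funD; exact: mF.
rewrite /F -[leLHS]ge0_muleDr ?mule_ge0 // -[leRHS]ge0_muleDr ?mule_ge0 //
  lee_wpmul2l ?lee_fin ?weight_ge0 //.
exact: mule_AMGM.
Qed.

End Reflection.
End Weights.

(** * Reflections of the discrete torus *)

(* The reflection centred between positions [k - 1] and [k] exchanges
   [k - 1 - j] and [k + j]; it serves both for the edges of a row and for
   every other row. *)
Lemma reflection_spread (T : Type) (good : T -> Prop) (x : T -> int -> Prop)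
    (H : nat) : (0 < H)%N ->
  (forall S k, x S (k + H%:Z) <-> x S k) ->
  (forall S k, good S -> exists2 S', good S' &
     forall j : nat, (j.*2 < H)%N -> x S (k - 1 - j%:Z) ->
       x S' (k - 1 - j%:Z) /\ x S' (k + j%:Z)) ->
  forall S k0, good S -> x S k0 -> exists2 S', good S' & forall k, x S' k.
Proof.
move=> H0 per step S k0 gS xS.
have perq S' k (q : nat) : x S' (k + q%:Z * H%:Z) <-> x S' k.
  elim: q => [|q IH]; first by rewrite mul0r addr0.
  by rewrite intS mulrDl mul1r addrCA addrC per.
have perz S' k (q : int) : x S' (k + q * H%:Z) <-> x S' k.
  case: q => q; first exact: perq.
  by rewrite NegzE -(perq _ _ q.+1) mulNr subrK.
have main l : (l < H)%N -> exists2 S', good S' &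
    forall k : nat, (k <= l)%N -> x S' (k0 + k%:Z).
  elim: l => [_|l IH lH].
    by exists S => // k; rewrite leqn0 => /eqP ->; rewrite addr0.
  have [S1 gS1 xS1] := IH (ltnW lH).
  (* Reflecting just beyond the right end of the run makes position [l.+1] the image of position
     [l]. *)
  have [S2 gS2 xS2] := step S1 (k0 + l.+1%:Z) gS1.
  exists S2 => // k kl.
  have [E|kl'] := eqVneq k l.+1.
    have [|_] := xS2 0%N H0; last by rewrite addr0 E.
    by have := xS1 l (leqnn l); congr x; lia.
  pose j := (l - k)%N.
  have [jH|jH] := ltnP j.*2 H.
    have [|+ _] := xS2 j jH.
      by have := xS1 k; rewrite (_ : k0 + l.+1%:Z - 1 - j%:Z = k0 + k%:Z) /j; [apply|]; lia.
    by congr x; rewrite /j; lia.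
  (* A position of the run too far to the left to be kept is recovered one period later, as the
     mirror image of position [l - j'], which is near enough. *)
  pose j' := (H - j - 1)%N.
  have j'H : (j'.*2 < H)%N by rewrite /j'; lia.
  have [|_] := xS2 j' j'H.
    have -> : k0 + l.+1%:Z - 1 - j'%:Z = k0 + (l - j')%N%:Z by rewrite /j' /j; lia.
    by apply: xS1; lia.
  rewrite (_ : k0 + l.+1%:Z + j'%:Z = k0 + k%:Z + H%:Z) ?per //.
  by rewrite /j' /j; lia.
have [S' gS' xS'] := main H.-1 ltac:(lia).
exists S' => // k.
have Hne : H%:Z != 0 by lia.
have Hk : x S' (k0 + ((k - k0) %% H%:Z)%Z).
  have m0 := modz_ge0 (k - k0) Hne.
  have := ltz_pmod (k - k0) (d := H%:Z) ltac:(lia).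
  move: (((k - k0) %% H%:Z)%Z) m0 => [r|//] _ rH.
  by apply: xS'; lia.
rewrite (_ : k = k0 + ((k - k0) %% H%:Z)%Z + ((k - k0) %/ H%:Z)%Z * H%:Z) ?perz //.
by have := divz_eq (k - k0) H%:Z; lia.
Qed.

Section TorusGeometry.
Variable n : nat.
Hypothesis hn : (0 < n)%N.
Local Notation N := (n.*2).

Lemma torus_pos_lt (z : int) : (`|(z %% N%:Z)%Z| < N)%N.
Proof.
have := modz_ge0 z (d := N%:Z) ltac:(lia).
have := ltz_pmod z (d := N%:Z) ltac:(lia).
by move: (z %% N%:Z)%Z => [r|r]; lia.
Qed.

Definition torus_pos (z : int) : 'I_N := Ordinal (torus_pos_lt z).

Lemma torus_posP (z : int) : exists q : int, z = (torus_pos z)%:Z + q * N%:Z.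
Proof.
exists (z %/ N%:Z)%Z => /=; have := divz_eq z N%:Z.
have := modz_ge0 z (d := N%:Z) ltac:(lia).
by move: (z %% N%:Z)%Z => [r|r]; lia.
Qed.

Lemma torus_pos_addM (z q : int) : torus_pos (z + q * N%:Z) = torus_pos z.
Proof. by apply: val_inj => /=; rewrite addrC modzMDl. Qed.

Lemma torus_pos_ord (i : 'I_N) : torus_pos i%:Z = i.
Proof. by apply: val_inj => /=; rewrite modz_nat absz_nat modn_small. Qed.

Lemma torus_posE (z q : int) (r : nat) : (r < N)%N -> z = r%:Z + q * N%:Z ->
  torus_pos z = r :> nat.
Proof.
by move=> rN ->; rewrite torus_pos_addM (torus_pos_ord (Ordinal rN)).
Qed.

(** The reflection through the position [b], which also fixes its antipode. *)
Definition torus_refl (b i : 'I_N) : 'I_N := torus_pos (b%:Z + b%:Z - i%:Z).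

Lemma torus_refl_pos (k z : int) :
  torus_refl (torus_pos k) (torus_pos z) = torus_pos (k + k - z).
Proof.
have [q kq] := torus_posP k; have [q' zq'] := torus_posP z.
rewrite /torus_refl [in RHS]kq [in RHS]zq' -(torus_pos_addM _ (q + q - q')).
by congr torus_pos; ring.
Qed.

(** The number of windings is -1, 0 or 1 by size; the three cases make the geometry below accessible
    to linear arithmetic. *)
Lemma torus_reflP (b i : 'I_N) :
  [\/ (torus_refl b i + i = b + b)%N, (torus_refl b i + i = b + b + N)%N
    | (torus_refl b i + i + N = b + b)%N].
Proof.
have [q] := torus_posP (b%:Z + b%:Z - i%:Z); rewrite -/(torus_refl b i).
have := ltn_ord b; have := ltn_ord i; have := ltn_ord (torus_refl b i).
move: (nat_of_ord (torus_refl b i)) => r rN iN bN E.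
have : q = 0 \/ q = 1 \/ q = -1 by nia.
by case=> [|[]] ?; subst q; [constructor 1|constructor 3|constructor 2]; lia.
Qed.

Lemma torus_reflK (b : 'I_N) : involutive (torus_refl b).
Proof.
move=> i; apply: ord_inj.
have := ltn_ord b; have := ltn_ord i; have := ltn_ord (torus_refl b (torus_refl b i)).
have := ltn_ord (torus_refl b i).
have := torus_reflP b i; have := torus_reflP b (torus_refl b i).
by case=> ?; case=> ?; lia.
Qed.

(** The open arc running from the antipode of [b] up to [b]; the second disjunct is its portion
    wrapped below zero. *)
Definition torus_side (b i : 'I_N) : bool :=
  (((i < b) && (b < i + n)) || (b + n < i))%N.

Lemma diff1P (i j : 'I_N) : reflect
  [\/ j = i.+1 :> nat, i = j.+1 :> nat, (i.+1 = N /\ j = 0%N :> nat)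
    | (j.+1 = N /\ i = 0%N :> nat)] (diff1 i j).
Proof.
have iN := ltn_ord i; have jN := ltn_ord j.
have wrap (a : nat) : (a < N)%N -> (a.+1 %% N)%N = if a.+1 == N then 0%N else a.+1.
  move=> aN; case: eqP => [->|?]; first by rewrite modnn.
  by rewrite modn_small //; lia.
rewrite /diff1 !wrap //; apply: (iffP orP).
  case; case: ifP => /eqP h /eqP e.
  - by constructor 3.
  - by constructor 1.
  - by constructor 4.
  - by constructor 2.
case=> [e|e|[e e']|[e e']].
- by left; case: ifP => /eqP h; apply/eqP; lia.
- by right; case: ifP => /eqP h; apply/eqP; lia.
- by left; rewrite e eqxx e'.
- by right; rewrite e eqxx e'.
Qed.

Lemma diff1_refl (b i j : 'I_N) :
  diff1 (torus_refl b i) (torus_refl b j) = diff1 i j.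
Proof.
suff H i' j' : diff1 i' j' -> diff1 (torus_refl b i') (torus_refl b j').
  by apply/idP/idP => [/H|/H //]; rewrite !torus_reflK.
have := torus_reflP b i'; have := torus_reflP b j'.
have := ltn_ord (torus_refl b i'); have := ltn_ord (torus_refl b j').
have := ltn_ord i'; have := ltn_ord j'; have := ltn_ord b.
move: (torus_refl b i') (torus_refl b j') => r r' bN jN iN rN r'N.
move=> h1 h2 /diff1P h3; apply: contraT => /diff1P h4.
have [a1 a2 a3 a4] : [/\ r' <> r.+1 :> nat, r <> r'.+1 :> nat, ~ (r.+1 = N /\ r' = 0%N :> nat)
    & ~ (r'.+1 = N /\ r = 0%N :> nat)].
  by split=> h; apply: h4; [constructor 1|constructor 2|constructor 3|constructor 4].
by case: h1 => h1; case: h2 => h2; case: h3 => [h3|h3|[h3 h3']|[h3 h3']]; lia.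
Qed.

Lemma torus_side_refl (b i : 'I_N) : torus_side b i -> ~~ torus_side b (torus_refl b i).
Proof.
have := torus_reflP b i.
have := ltn_ord (torus_refl b i); have := ltn_ord i; have := ltn_ord b.
by rewrite /torus_side => ? ? ?; case=> ?; lia.
Qed.

Lemma torus_refl_fix (b i : 'I_N) :
  ~~ torus_side b i -> ~~ torus_side b (torus_refl b i) -> torus_refl b i = i.
Proof.
have := torus_reflP b i => H h1 h2; apply: ord_inj; move: H h1 h2.
have := ltn_ord (torus_refl b i); have := ltn_ord i; have := ltn_ord b.
by rewrite /torus_side => ? ? ?; case=> ?; lia.
Qed.

Lemma torus_side_sep (b i j : 'I_N) : diff1 i j -> torus_side b i ->
  ~~ torus_side b (torus_refl b j).
Proof.
have := torus_reflP b j.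
have := ltn_ord (torus_refl b j); have := ltn_ord i; have := ltn_ord b.
have := ltn_ord j.
rewrite /torus_side => ? ? ? ? h /diff1P h'.
by case: h => ?; case: h' => [?|?|[? ?]|[? ?]]; lia.
Qed.

Lemma torus_side_center (b : 'I_N) : ~~ torus_side b b.
Proof. by rewrite /torus_side; lia. Qed.

Lemma torus_refl_center (b : 'I_N) : torus_refl b b = b.
Proof. by rewrite /torus_refl addrK torus_pos_ord. Qed.

(** The closed arc behind [k], both fixed points included, avoids the mirror arc: marks there
    survive [reflectA]. *)
Lemma torus_side_closed (k : int) (d : nat) : (d <= n)%N ->
  ~~ torus_side (torus_pos k) (torus_refl (torus_pos k) (torus_pos (k - d%:Z))).
Proof.
move=> dn; rewrite torus_refl_pos (_ : k + k - (k - d%:Z) = k + d%:Z); last by ring.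
have [q kq] := torus_posP k; have bN := ltn_ord (torus_pos k).
have [h|h] := ltnP (torus_pos k + d) N.
  have E : torus_pos (k + d%:Z) = (torus_pos k + d)%N :> nat.
    by apply: (torus_posE (q := q)) => //; lia.
  by rewrite /torus_side E; lia.
have E : torus_pos (k + d%:Z) = (torus_pos k + d - N)%N :> nat.
  by apply: (torus_posE (q := q + 1)); lia.
by rewrite /torus_side E; lia.
Qed.

End TorusGeometry.

(** * Spreading one marked edge to every other line of the torus *)

Section Spreading.
Context {R : realType} {n : nat}.
Variable hn : (0 < n)%N.
Local Notation V := (tvert n).
Variable k : bool -> R -> R.
Hypothesis mk : forall b, measurable_fun setT (k b).
Hypothesis k0 : forall b x, 0 <= k b x.

(** Both orientations are kept, since the representatives chosen in [tedges] need not be respected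
    by reflections. *)
Definition tadjp (e : V * V) : bool := tadj e.1 e.2.

(** The flag [c] selects the coordinate that varies along a line, so that one argument serves rows
    and columns. *)
Definition dirv (c : bool) (i j : 'I_n.*2) : V := if c then (i, j) else (j, i).
Definition dcoord (c : bool) (v : V) := if c then v.1 else v.2.

Definition vrefl (c : bool) (b : 'I_n.*2) (v : V) : V :=
  if c then (torus_refl hn b v.1, v.2) else (v.1, torus_refl hn b v.2).

Lemma dcoord_vrefl c b v : dcoord c (vrefl c b v) = torus_refl hn b (dcoord c v).
Proof. by case: c. Qed.

Lemma vreflK c b : involutive (vrefl c b).
Proof. by case: c => -[i j]; rewrite /vrefl /= torus_reflK. Qed.

Lemma tadj_vrefl c b e : tadjp (edge_map (vrefl c b) e) = tadjp e.
Proof.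
have inj := inj_eq (inv_inj (torus_reflK hn b)).
by case: c; rewrite /tadjp /tadj /= diff1_refl inj.
Qed.

Lemma tadj_sep c b e : tadjp e ->
  torus_side b (dcoord c e.1) || torus_side b (dcoord c e.2) ->
  ~~ (torus_side b (dcoord c (vrefl c b e.1)) ||
      torus_side b (dcoord c (vrefl c b e.2))).
Proof.
rewrite !dcoord_vrefl => adj.
have {adj} : (dcoord c e.1 == dcoord c e.2) || diff1 (dcoord c e.1) (dcoord c e.2).
  move: adj; rewrite /tadjp /tadj /dcoord.
  by case: c => /orP[] /andP[h1 h2]; rewrite ?h1 ?h2 ?orbT.
move: (dcoord c e.1) (dcoord c e.2) => i j.
have S := torus_side_refl hn (b := b).
case/orP => [/eqP -> /orP[] /S /negbTE -> //|ij].
have ji : diff1 j i by rewrite /diff1 orbC.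
case/orP => h; rewrite (negbTE (S _ h)).
  by rewrite (torus_side_sep hn ij h).
by rewrite orbF (torus_side_sep hn ji h).
Qed.

Definition maximal_set (S : pred (V * V)) : Prop :=
  forall v0 S', (pf k tadjp v0 S' <= pf k tadjp v0 S)%E.

(** There are finitely many edge sets, so a maximizer exists for the pin [v1]; [pf_repin] transfers
    maximality to the other pins. *)
Lemma exists_maximal_set S1 v1 : exists2 S, maximal_set S &
  (pf k tadjp v1 S1 <= pf k tadjp v1 S)%E.
Proof.
pose F (s : {set V * V}) := pf k tadjp v1 (fun e => e \in s).
have FE S : pf k tadjp v1 S = F (finset S).
  by apply: eq_pf => e _; rewrite inE.
pose s := [arg max_(s > finset S1) F s]%O.
have Fs s' : (F s' <= F s)%E by rewrite /s; case: arg_maxP => // s0 _; apply.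
exists (fun e => e \in s); last by rewrite FE.
by move=> v0 S'; rewrite !(pf_repin mk k0 _ v0 v1) FE.
Qed.

Hypothesis pf_fin : forall v0 S, (pf k tadjp v0 S < +oo)%E.

(** Maximality of [S] bounds the [reflectB] term of [pf_reflection]; cancelling it, by finiteness,
    shows that [reflectA] loses nothing. Edges without an end in the mirror half keep their marks
    and acquire mirror copies. *)
Lemma maximal_set_reflection c b S : maximal_set S ->
  exists2 S', maximal_set S' &
    forall e, ~~ torus_side b (torus_refl hn b (dcoord c e.1)) ->
      ~~ torus_side b (torus_refl hn b (dcoord c e.2)) ->
      S e -> S' e /\ S' (edge_map (vrefl c b) e).
Proof.
move=> maxS; pose A v := torus_side b (dcoord c v).
pose S' := reflectA A (vrefl c b) S.
have fixv v : ~~ A v -> ~~ A (vrefl c b v) -> vrefl c b v = v.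
  rewrite /A dcoord_vrefl => h1 h2; have := torus_refl_fix h1 h2.
  by rewrite /vrefl /dcoord; case: c {h1 h2 A S'} v => -[i j] /= ->.
exists S' => [v0 S1|e].
  apply: le_trans (maxS v0 S1) _.
  rewrite (pf_repin mk k0 _ v0 (dirv c b b)) [leRHS](pf_repin mk k0 _ v0 (dirv c b b)).
  set w := dirv c b b.
  have wb : dcoord c w = b by rewrite /w /dirv /dcoord; case: (c).
  have refl_le : (pf k tadjp w S + pf k tadjp w S <= pf k tadjp w S' +
      pf k tadjp w (reflectB A (vrefl c b) S))%E.
    apply: pf_reflection => //.
    - exact: vreflK.
    - exact: tadj_vrefl.
    - by move=> v; rewrite /A dcoord_vrefl; exact: torus_side_refl.
    - exact: tadj_sep.
    - by rewrite /A wb torus_side_center.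
    - by rewrite /w /dirv /vrefl; case: (c) => /=; rewrite torus_refl_center.
  have fin S2 : pf k tadjp w S2 \is a fin_num.
    by rewrite ge0_fin_numE ?pf_fin // pf_ge0.
  have le2 := maxS w (reflectB A (vrefl c b) S).
  have := le_trans refl_le (leeD2l (pf k tadjp w S') le2).
  by rewrite leeD2rE.
rewrite -!dcoord_vrefl -!/(A _) => /negbTE h1 /negbTE h2 Se.
rewrite /S' /reflectA /= h1 h2 /= !vreflK.
case: ifPn => [_|]; first by rewrite /edge_map /= !vreflK -surjective_pairing.
(* An edge inside the cut is its own mirror image. *)
rewrite negb_or => /andP[a1 a2].
by rewrite /edge_map (fixv e.1) ?h1 // (fixv e.2) ?h2 // -surjective_pairing.
Qed.

(** Orientation is forgotten because a reflection across a line may reverse an edge. *)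
Definition present (S : pred (V * V)) (u v : V) := S (u, v) || S (v, u).

Lemma presentC S u v : present S u v = present S v u.
Proof. exact: orbC. Qed.

Lemma present_reflection c b S : maximal_set S ->
  exists2 S', maximal_set S' &
    forall u v, ~~ torus_side b (torus_refl hn b (dcoord c u)) ->
      ~~ torus_side b (torus_refl hn b (dcoord c v)) ->
      present S u v -> present S' u v /\ present S' (vrefl c b u) (vrefl c b v).
Proof.
move=> /(maximal_set_reflection c b)[S' maxS' H]; exists S' => // u v hu hv.
case/orP => h.
  by have [h1 h2] := H (u, v) hu hv h; rewrite /present h1 h2.
by have [h1 h2] := H (v, u) hv hu h; rewrite /present h1 h2 !orbT.
Qed.

Local Notation tpos := (torus_pos hn).

(** [reflection_spread] is used twice: along the line of the marked edge, where edge positions have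
    period [2n], then across lines. Reflections through lines preserve the parity of the line index,
    so only every other line is filled. *)
Lemma maximal_set_spread S e : maximal_set S -> tadjp e -> S e ->
  exists S' (c : bool) (r : nat), maximal_set S' /\
    forall i i' j : 'I_n.*2, i' = i.+1 :> nat -> odd j = odd r ->
      present S' (dirv c i j) (dirv c i' j).
Proof.
move=> maxS adj Se.
have [c [r [z0 pz0]]] : exists c (r : 'I_n.*2) (z0 : int),
    present S (dirv c (tpos z0) r) (dirv c (tpos (z0 + 1)) r).
  have succ (i i' : 'I_n.*2) : diff1 i i' -> i' = tpos (i%:Z + 1) \/ i = tpos (i'%:Z + 1).
    have tposS (a b : 'I_n.*2) : (a.+1 %% n.*2)%N == b -> b = tpos (a%:Z + 1).
      move=> /eqP ab; apply: ord_inj; rewrite -ab.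
      by rewrite -[RHS]/`|((a%:Z + 1) %% n.*2)%Z|%N -PoszD modz_nat absz_nat addn1.
    by case/orP => /tposS; [left|right].
  case: e adj Se => -[a b] [a' b'] /orP[] /= /andP[/eqP <- /succ[] E] Se.
  - exists false, a, b; rewrite -E torus_pos_ord; exact/orP/or_introl.
  - exists false, a, b'; rewrite -E torus_pos_ord; exact/orP/or_intror.
  - exists true, b, a; rewrite -E torus_pos_ord; exact/orP/or_introl.
  - exists true, b, a'; rewrite -E torus_pos_ord; exact/orP/or_intror.
have tposE z z' : z = z' -> tpos z = tpos z' by move=> ->.
have [S1 maxS1 row1] : exists2 S1, maximal_set S1 & forall z,
    present S1 (dirv c (tpos z) r) (dirv c (tpos (z + 1)) r).
  apply: (@reflection_spread _ maximal_set (fun S z =>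
    present S (dirv c (tpos z) r) (dirv c (tpos (z + 1)) r)) n.*2) maxS pz0.
  - by lia.
  - by move=> S1 z; rewrite addrAC -[(n.*2)%:Z]mul1r !torus_pos_addM.
  move=> S1 z maxS1; have [S2 maxS2 H] := present_reflection c (tpos z) maxS1.
  exists S2 => // j jn pj.
  have cd x y : dcoord c (dirv c x y) = x by rewrite /dcoord /dirv; case: (c).
  have rd x y : vrefl c (tpos z) (dirv c x y) = dirv c (torus_refl hn (tpos z) x) y.
    by rewrite /vrefl /dirv; case: (c).
  have [||p1 p2] := H _ _ _ _ pj; rewrite ?cd.
  - by rewrite (_ : z - 1 - j%:Z = z - j.+1%:Z); [apply: torus_side_closed|]; lia.
  - by rewrite (_ : z - 1 - j%:Z + 1 = z - j%:Z); [apply: torus_side_closed|]; lia.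
  (* The mirror image of an edge of the line is traversed backwards. *)
  split=> //; rewrite presentC; move: p2; rewrite !rd !torus_refl_pos.
  by congr (present _ (dirv _ _ _) (dirv _ _ _)); apply: tposE; lia.
(* The index [i] denotes the line [r + 2i], so the period in [i] is [n]. *)
pose full S (i : int) := forall z, present S (dirv c (tpos z) (tpos (r%:Z + i + i)))
  (dirv c (tpos (z + 1)) (tpos (r%:Z + i + i))).
have full0 : full S1 0 by move=> z; rewrite !addr0 torus_pos_ord.
have [S2 maxS2 full2] : exists2 S2, maximal_set S2 & forall i, full S2 i.
  apply: (@reflection_spread _ maximal_set full n) maxS1 full0 => //.
    move=> S2 i; rewrite /full (_ : r%:Z + (i + n%:Z) + (i + n%:Z) = r%:Z + i + i + 1 * (n.*2)%:Z).
      by rewrite torus_pos_addM.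
    by lia.
  (* The line midway between those of index [i - 1] and [i]; the line of index [i - 1 - j] lies at
     distance [2j + 1] from it. *)
  move=> S2 i maxS2; set b := tpos (r%:Z + i + i - 1).
  have [S3 maxS3 H] := present_reflection (~~ c) b maxS2.
  exists S3 => // j jn pj.
  have cd x y : dcoord (~~ c) (dirv c x y) = y by rewrite /dcoord /dirv; case: (c).
  have rd x y : vrefl (~~ c) b (dirv c x y) = dirv c x (torus_refl hn b y).
    by rewrite /vrefl /dirv; case: (c).
  have side : ~~ torus_side b (torus_refl hn b
      (tpos (r%:Z + (i - 1 - j%:Z) + (i - 1 - j%:Z)))).
    rewrite (_ : r%:Z + _ + _ = r%:Z + i + i - 1 - (j.*2.+1)%:Z); last by lia.
    by apply: torus_side_closed; lia.
  split=> z; have := pj z; move/(H _ _); rewrite !cd => /(_ side side) [] //.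
  move=> _; rewrite !rd /b !torus_refl_pos.
  by congr (present _ (dirv _ _ _) (dirv _ _ _)); apply: tposE; lia.
exists S2, c, r; split=> // i i' j ii' jr.
have [q jq] : exists q : int, j%:Z = r%:Z + q + q.
  exists (((j%:Z - r%:Z) %/ 2)%Z).
  lia.
have := full2 q i%:Z; rewrite -jq !torus_pos_ord.
congr (present _ _ (dirv _ _ _)); apply: ord_inj; rewrite ii'.
by apply: (@torus_posE n hn (i%:Z + 1) 0 i.+1); have := ltn_ord i'; lia.
Qed.

End Spreading.

(** * Bounds on the partition function *)

Section TreeBound.
Context {R : realType} {n : nat}.
Local Notation V := (tvert n).
Local Notation mu := (@lebesgue_measure R).
Variables (v0 : V) (parent : V -> V) (rank : V -> nat).
Hypothesis rank_parent : forall v, v != v0 -> (rank (parent v) < rank v)%N.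

(** With vertices sorted by increasing rank, the parent of [v] is fixed before [v] is integrated,
    and a translation by its height makes each factor a one-dimensional integral. *)
Lemma iint_tree (h : V -> R -> R) (c : V -> R) :
  (forall v, measurable_fun setT (h v)) -> (forall v x, 0 <= h v x) ->
  (forall v, (\int[mu]_(x in setT) (h v x)%:E)%E = (c v)%:E) ->
  forall phi, iint (others v0)
    (fun psi => (\prod_(v | v != v0) h v (psi v - psi (parent v)))%:E) phi =
  (\prod_(v | v != v0) c v)%:E.
Proof.
move=> mh h0 hc.
pose le_rank := relpre rank leq.
pose s := sort le_rank (others v0).
have ps : perm_eq (others v0) s by rewrite perm_sym; exact/permEl/perm_sort.
have sv v : v \in s -> v != v0 by rewrite -(perm_mem ps) mem_others.
have us : uniq s by rewrite -(perm_uniq ps) others_uniq.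
have pws : pairwise le_rank s.
  rewrite -sorted_pairwise; last by move=> a b d; rewrite /le_rank /=; exact: leq_trans.
  by apply: sort_sorted => a b; exact: leq_total.
have bigs (F : V -> R) : \prod_(v | v != v0) F v = \prod_(v <- s) F v.
  rewrite -(perm_big _ ps) -big_filter; apply: perm_big.
  apply: uniq_perm; rewrite ?filter_uniq ?index_enum_uniq ?others_uniq // => v.
  by rewrite mem_filter mem_index_enum andbT mem_others.
pose f (s' : seq V) (psi : V -> R) := \prod_(v <- s') h v (psi v - psi (parent v)).
have f0 s' psi : (0 <= (f s' psi)%:E)%E by rewrite lee_fin prodr_ge0.
have mh1 v : cmeas (fun psi : V -> R => (h v (psi v - psi (parent v)))%:E).
  move=> d T g mg; apply/measurable_EFinP; apply: (measurableT_comp (mh v)).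
  by apply: measurable_funB; exact: mg.
have mf s' : cmeas (fun psi => (f s' psi)%:E).
  move=> d T g mg; apply/measurable_EFinP; apply: measurable_prod => v _.
  by apply/measurable_EFinP; exact: (mh1 v _ _ g).
move=> phi; rewrite (eq_iint _ (g := fun psi => (f s psi)%:E)); last first.
  by move=> psi; rewrite bigs.
rewrite (iint_perm _ _ (mf s) ps) // bigs.
elim: s sv us pws phi {ps bigs} => [|v s IH] sv us pws phi.
  by rewrite /= /f !big_nil.
move: us pws => /= /andP[vs us] /andP[/allP vle pws].
have vv0 : v != v0 by apply: sv; rewrite mem_head.
have pvs : parent v \notin s.
  by apply/negP => /vle; rewrite /le_rank /= leqNgt rank_parent.
have pvv : parent v != v by apply: contraTneq (rank_parent vv0) => ->; rewrite ltnn.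
rewrite [RHS](_ : _ = (c v)%:E * (\prod_(w <- s) c w)%:E)%E; last first.
  by rewrite big_cons EFinM.
rewrite -hc -(ge0_integral_translate (- phi (parent v))); last 2 first.
- by apply/measurable_EFinP.
- by move=> x; rewrite lee_fin.
rewrite muleC -ge0_integralZl //; last 3 first.
- apply/measurable_EFinP; apply: (measurableT_comp (mh v)).
  exact: measurable_funD.
- by move=> x _; rewrite lee_fin.
- rewrite lee_fin prodr_ge0 // => w _; rewrite -lee_fin -hc.
  by apply: integral_ge0 => x _; rewrite lee_fin.
apply: eq_integral => x _.
rewrite (eq_iint _ (g := fun psi => (h v (psi v - psi (parent v)))%:E * (f s psi)%:E)%E);
  last by move=> psi; rewrite /f big_cons EFinM.
rewrite (iintZ (c := fun psi => (h v (psi v - psi (parent v)))%:E)) //.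
- rewrite IH // ?updE ?eqxx ?(negbTE pvv) 1?muleC //.
  by move=> w ws; apply: sv; rewrite inE ws orbT.
- by move=> psi; rewrite lee_fin.
- by move=> f1 f2 E; rewrite !E.
Qed.

(** The two orientations of a tree edge are bounded jointly by [h], every other directed edge by
    [M]; since [1 <= M], one factor [M] may be spent on each edge, tree edges included. *)
Lemma weight_tree_le (k : bool -> R -> R) (E S : pred (V * V)) (M : R)
    (h : V -> R -> R) phi :
  1 <= M -> (forall b x, 0 <= k b x <= M) ->
  (forall v, v != v0 -> E (v, parent v) && E (parent v, v)) ->
  (forall v x, v != v0 -> k (S (v, parent v)) x * k (S (parent v, v)) (- x) <= h v x) ->
  weight k E S phi <=
    M ^+ #|E| * \prod_(v | v != v0) h v (phi v - phi (parent v)).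
Proof.
move=> M1 kM Ep kh; have k0 b x : 0 <= k b x by case/andP: (kM b x).
have kleM b x : k b x <= M by case/andP: (kM b x).
pose a (e : V * V) := k (S e) (phi e.1 - phi e.2).
pose up (e : V * V) := (e.1 != v0) && (e.2 == parent e.1).
pose dn (e : V * V) := (e.2 != v0) && (e.1 == parent e.2).
pose pick (c : pred (V * V)) e := if c e then a e else 1.
have -> : weight k E S phi = \prod_(e | E e) a e by [].
apply: (@le_trans _ _ (\prod_(e | E e) (M * (pick up e * pick dn e)))).
  apply: ler_prod => e _; rewrite k0 /= /pick.
  case Hu: (up e); case Hd: (dn e); rewrite ?mulr1 ?mul1r; last exact: kleM.
  (* An edge leading to the parent in both directions would decrease the rank twice and return to
     its start. *)
  - move: Hu Hd => /andP[u1 /eqP u2] /andP[d1 /eqP d2].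
    have := rank_parent u1; have := rank_parent d1.
    by rewrite -u2 -d2 => /ltn_trans /[apply]; rewrite ltnn.
  - by rewrite ler_peMl ?k0.
  - by rewrite ler_peMl ?k0.
rewrite big_split /= prodr_const; apply: ler_wpM2l.
  by rewrite exprn_ge0 // (le_trans ler01).
have pickE (c : pred (V * V)) (i : V -> V * V) (j : V * V -> V) :
    (forall e, E e -> c e -> i (j e) = e) ->
    (forall v, E (i v) && c (i v) && (j (i v) == v) = (v != v0)) ->
    \prod_(e | E e) pick c e = \prod_(v | v != v0) a (i v).
  move=> ij Ei; rewrite -big_mkcondr /= (reindex_onto i j) /=; last first.
    by move=> e /andP[]; exact: ij.
  by apply: eq_bigl => v; exact: Ei.
rewrite big_split /= (pickE up (fun v => (v, parent v)) fst); last 2 first.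
- by move=> [x y] _ /andP[/= _ /eqP ->].
- move=> v; rewrite /up /= !eqxx !andbT.
  by case vv0: (v != v0); rewrite ?andbF //; have /andP[->] := Ep _ vv0.
rewrite (pickE dn (fun v => (parent v, v)) snd); last 2 first.
- by move=> [x y] _ /andP[/= _ /eqP ->].
- move=> v; rewrite /dn /= !eqxx !andbT.
  by case vv0: (v != v0); rewrite ?andbF //; have /andP[_ ->] := Ep _ vv0.
rewrite -big_split /=; apply: ler_prod => v vv0; rewrite mulr_ge0 ?k0 //=.
by rewrite /a /= -(opprB (phi v)); exact: kh.
Qed.

Lemma pf_tree_le (k : bool -> R -> R) (E S : pred (V * V)) (M : R)
    (h : V -> R -> R) (c : V -> R) :
  (forall b, measurable_fun setT (k b)) ->
  1 <= M -> (forall b x, 0 <= k b x <= M) ->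
  (forall v, v != v0 -> E (v, parent v) && E (parent v, v)) ->
  (forall v, measurable_fun setT (h v)) -> (forall v x, 0 <= h v x) ->
  (forall v, (\int[mu]_(x in setT) (h v x)%:E)%E = (c v)%:E) ->
  (forall v x, v != v0 -> k (S (v, parent v)) x * k (S (parent v, v)) (- x) <= h v x) ->
  (pf k E v0 S <= (M ^+ #|E| * \prod_(v | v != v0) c v)%:E)%E.
Proof.
move=> mk M1 kM Ep mh h0 hc kh; have k0 b x : 0 <= k b x by case/andP: (kM b x).
have mh1 : cmeas (fun psi : V -> R =>
    (\prod_(v | v != v0) h v (psi v - psi (parent v)))%:E).
  move=> d T g mg; apply/measurable_EFinP.
  under [X in measurable_fun _ X]eq_fun do rewrite big_mkcond.
  apply: measurable_prod => v _; case: (v != v0) => //.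
  by apply: (measurableT_comp (mh v)); apply: measurable_funB; exact: mg.
rewrite EFinM -(iint_tree mh h0 hc (fun=> 0)).
rewrite -(iintZ (c := fun=> (M ^+ #|E|)%:E)) //.
- apply: iint_le.
  + by move=> psi; rewrite lee_fin weight_ge0.
  + exact: cmeas_weight.
  + by apply: cmeas_mule => // d T g mg; exact: measurable_cst.
  + by move=> psi; rewrite -EFinM lee_fin; exact: weight_tree_le.
- by move=> psi; rewrite lee_fin prodr_ge0.
- by move=> psi; rewrite lee_fin exprn_ge0 // (le_trans ler01).
Qed.

End TreeBound.

(** * Counting vertices and directed edges *)

Section Degree.
Variable n : nat.
Local Notation V := (tvert n).

Lemma card_tvert : #|{: V}| = (4 * n ^ 2)%N.
Proof. by rewrite card_prod !card_ord; lia. Qed.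

Lemma tadj_sym (v w : V) : tadj v w = tadj w v.
Proof.
by rewrite /tadj /diff1 ![w.1 == _]eq_sym ![w.2 == _]eq_sym orbC
  [X in _ && X || _]orbC [X in _ || _ && X]orbC orbC.
Qed.

Hypothesis hn : (0 < n)%N.

Lemma tadj_irr (v : V) : tadj v v = false.
Proof.
rewrite /tadj !eqxx /=.
have irr (i : 'I_n.*2) : diff1 i i = false.
  by apply/negP => /(diff1P hn); case=> [?|?|[? ?]|[? ?]]; lia.
by rewrite !irr.
Qed.

Lemma tadj_degree (v : V) : (#|[pred w | tadj v w]| <= 4)%N.
Proof.
pose s := [:: (v.1, ordS v.2); (v.1, ord_pred v.2); (ordS v.1, v.2); (ord_pred v.1, v.2)].
have diffE (i j : 'I_n.*2) : diff1 i j = (j == ordS i) || (j == ord_pred i).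
  rewrite /diff1 -(can2_eq (@ordSK _) (@ord_predK _)) [j == _]eq_sym.
  by rewrite -!(inj_eq (@ord_inj _)).
apply: leq_trans (card_size s); apply/subset_leq_card/fintype.subsetP => -[a b].
rewrite !inE /tadj /= !diffE !xpair_eqE ![v.1 == _]eq_sym ![v.2 == _]eq_sym.
case/orP => /andP[-> /orP[] ->]; rewrite ?orbT //.
Qed.

Lemma card_tadjp : (#|[pred e : V * V | tadjp e]| <= 16 * n ^ 2)%N.
Proof.
rewrite -sum1_card (eq_bigl (fun e => tadj e.1 e.2)) //.
rewrite -(pair_big_dep xpredT (fun v w => tadj v w) (fun _ _ => 1%N)) /=.
apply: (@leq_trans (\sum_(v : V) 4)%N).
  by apply: leq_sum => v _; rewrite sum1_card tadj_degree.
by rewrite sum_nat_const card_tvert; lia.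
Qed.

End Degree.

(** * Lower bound for the partition function without marks *)

Section LowerBound.
Context {R : realType} {n : nat}.
Hypothesis hn : (0 < n)%N.
Local Notation V := (tvert n).
Local Notation mu := (@lebesgue_measure R).
Variables (eps : R) (G : R -> bool).
Hypothesis eps0 : 0 < eps.
Hypothesis mG : measurable_fun setT G.
Hypothesis symG : forall x, G (- x) = G x.
Hypothesis bigG :
  (\int[mu]_(x in setT) ((`|x| <= 2 * eps) && ~~ G x)%:R%:E <= (eps / 4)%:E)%E.

Lemma measurable_natr_bool d (T : measurableType d) (c : T -> bool) :
  measurable_fun setT c -> measurable_fun setT (fun x => (c x)%:R : R).
Proof.
move=> mc; have -> : (fun x => (c x)%:R : R) = (fun x => if c x then 1 else 0).
  by apply/funext => x; case: (c x).
exact: measurable_fun_ifT.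
Qed.

Lemma measurable_norm_le d (T : measurableType d) (f : T -> R) (c : R) :
  measurable_fun setT f -> measurable_fun setT (fun x => `|f x| <= c).
Proof.
by move=> mf; apply: measurable_fun_ler => //; exact: measurableT_comp.
Qed.

Let window (x : R) : R := (`|x| <= eps)%R%:R.
(** Two heights in the window differ by at most [2 * eps], so bad gradients need control only in
    that range. *)
Let bad (x : R) : R := ((`|x| <= 2 * eps) && ~~ G x)%:R.

Let mwindow : measurable_fun setT window.
Proof. by apply: measurable_natr_bool; exact: measurable_norm_le. Qed.

Let mG1 : measurable_fun setT (fun x => (G x)%:R : R).
Proof. exact: measurable_natr_bool. Qed.

Let mbad : measurable_fun setT bad.
Proof.
apply: measurable_natr_bool; apply: measurable_and; first exact: measurable_norm_le.
exact: measurable_neg.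
Qed.

Let local_good (s : seq V) v (psi : V -> R) : R :=
  window (psi v) * \prod_(w | tadj v w && (w \notin s)) (G (psi v - psi w))%:R.

(* Only neighbours integrated before [v], or pinned, constrain the height at
   [v]: those are the ones outside the list still to be integrated. *)
Fixpoint good (s : seq V) (psi : V -> R) : R :=
  if s is v :: s' then local_good s v psi * good s' psi else 1.

Let local_good01 s v psi : local_good s v psi = 0 \/ local_good s v psi = 1.
Proof.
rewrite /local_good /window; case: (_ <= _); last by rewrite mul0r; left.
rewrite mul1r; elim/big_ind: _ => [|x y [->|->] [->|->]|w _].
- by right.
- by rewrite mul0r; left.
- by rewrite mul0r; left.
- by rewrite mulr0; left.
- by rewrite mulr1; right.
- by case: (G _); [right|left].
Qed.

Lemma good01 s psi : good s psi = 0 \/ good s psi = 1.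
Proof.
elim: s => [|v s IH] /=; first by right.
case: (local_good01 (v :: s) v psi) => ->; first by rewrite mul0r; left.
by rewrite mul1r.
Qed.

Lemma good_ge0 s psi : 0 <= good s psi.
Proof. by case: (good01 s psi) => ->. Qed.

Let local_good_ge0 s v psi : 0 <= local_good s v psi.
Proof. by case: (local_good01 s v psi) => ->. Qed.

Let cmeas_local_good s v : cmeas (fun psi => (local_good s v psi)%:E).
Proof.
move=> d T g mg; apply/measurable_EFinP; apply: measurable_funM.
  exact: (measurableT_comp mwindow).
under [X in measurable_fun _ X]eq_fun do rewrite big_mkcond.
apply: measurable_prod => w _; case: (_ && _) => //.
by apply: (measurableT_comp mG1); apply: measurable_funB; exact: mg.
Qed.

Lemma cmeas_good s : cmeas (fun psi => (good s psi)%:E).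
Proof.
elim: s => [|v s IH] d T g mg.
  by rewrite [_ \o _](_ : _ = cst 1%E) //; exact: measurable_cst.
rewrite [X in measurable_fun _ X](_ : _ =
    (fun t => (local_good (v :: s) v (g t))%:E * (good s (g t))%:E)%E); last first.
  by apply/funext => t /=; rewrite EFinM.
by apply: emeasurable_funM; [exact: cmeas_local_good|exact: IH].
Qed.

(** An edge is tested at whichever of its ends comes later in the list; the symmetry of [G] supplies
    the other orientation. *)
Lemma good_edges s psi : good s psi = 1 ->
  forall v w, v \in s -> tadj v w -> G (psi v - psi w).
Proof.
elim: s => [//|v s IH] /=.
case: (good01 s psi) => gs; rewrite gs ?mulr0 ?mulr1; first by move/esym/eqP; rewrite oner_eq0.
have {}IH := IH gs => lg.
have Gv w : tadj v w -> w \notin v :: s -> G (psi v - psi w).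
  move=> vw ws; apply: contraTT isT => nG; move: lg; rewrite /local_good.
  rewrite (bigD1 w) /=; last by rewrite vw ws.
  by rewrite (negbTE nG) mul0r mulr0 => /esym/eqP; rewrite oner_eq0.
have Gvs w : tadj v w -> G (psi v - psi w).
  move=> vw; have [|ws] := boolP (w \in v :: s); last exact: Gv.
  rewrite inE => /orP[/eqP wv|ws]; first by move: vw; rewrite wv tadj_irr.
  by rewrite -symG opprB; apply: IH => //; rewrite tadj_sym.
by move=> v' w; rewrite inE => /orP[/eqP ->|v's]; [exact: Gvs|exact: IH].
Qed.

(** The window has length [2 * eps], and each of the at most four neighbours excludes a set of
    measure at most [eps / 4], so at least [eps] remains. *)
Lemma integral_local_good (s : seq V) v phi : v \in s ->
  (forall w, w \notin s -> `|phi w| <= eps) ->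
  (eps%:E <= \int[mu]_(x in setT) (local_good s v (upd phi v x))%:E)%E.
Proof.
move=> vs phis.
pose nb := [pred w | tadj v w && (w \notin s)].
have mlg : measurable_fun setT (fun x : R => (local_good s v (upd phi v x))%:E).
  by apply: (@cmeas_local_good s v _ _ (fun x : R => upd phi v x)); apply: measurable_upd.
have mb w : measurable_fun setT (fun x : R => (bad (x - phi w))%:E).
  by apply/measurable_EFinP; apply: (measurableT_comp mbad); exact: measurable_funB.
have bad0 x : (0 <= (bad x)%:E)%E by rewrite lee_fin.
(* Pointwise union bound: a height in the window is admissible or makes a bad gradient with some
   neighbour. *)
have key x : ((window x)%:E <= (local_good s v (upd phi v x))%:E +
    \sum_(w <- enum nb) (bad (x - phi w))%:E)%E.
  have S0 : (0 <= \sum_(w <- enum nb) (bad (x - phi w))%:E)%E by apply: sume_ge0.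
  have lg0 := local_good_ge0 s v (upd phi v x).
  rewrite big_enum in S0 *.
  have [all|] := boolP [forall w in nb, G (x - phi w)].
    rewrite -[leLHS]adde0 leeD // lee_fin /local_good updE eqxx.
    rewrite big1 ?mulr1 // => w wnb; move/forall_inP: all => /(_ w wnb).
    rewrite updE; case: eqP => [wv|_ -> //].
    by move: wnb => /andP[+ _]; rewrite wv tadj_irr.
  rewrite negb_forall_in => /exists_inP[w wnb nG].
  rewrite /window; case: (lerP `|x| eps) => xe; last by rewrite adde_ge0 ?lee_fin.
  rewrite -[leLHS]add0e leeD ?lee_fin // (bigD1 w) //= -[leLHS]adde0 leeD //.
    rewrite lee_fin /bad nG andbT.
    have we : `|phi w| <= eps by apply: phis; case/andP: wnb.
    have -> // : `|x - phi w| <= 2 * eps.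
    by rewrite (le_trans (ler_normB _ _)) // mulr_natl mulr2n lerD.
  by apply: sume_ge0.
have iw : (\int[mu]_(x in setT) (window x)%:E = (2 * eps)%:E)%E.
  transitivity (\int[mu]_(x in setT) (\1_(`[- eps, eps]%classic) x)%:E)%E.
    by apply: eq_integral => x _; rewrite indicE /window mem_setE in_itv /= ler_norml.
  rewrite integral_indic // setIT.
  rewrite -[LHS]/(@lebesgue_measure R `[- eps, eps]%classic) lebesgue_measure_itv /= lte_fin.
  have e1 : - eps < eps by move: eps0; lra.
  by rewrite e1; congr EFin; ring.
have : ((2 * eps)%:E <= \int[mu]_(x in setT) (local_good s v (upd phi v x))%:E + eps%:E)%E.
  rewrite -iw; apply: (@le_trans _ _ (\int[mu]_(x in setT)
    ((local_good s v (upd phi v x))%:E + \sum_(w <- enum nb) (bad (x - phi w))%:E))%E).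
    apply: ge0_le_integral => //.
  - by move=> x _; rewrite lee_fin.
  - exact/measurable_EFinP.
  - by apply: emeasurable_funD => //; apply: emeasurable_sum.
  rewrite ge0_integralD //; last 3 first.
  - by move=> x _; rewrite lee_fin local_good_ge0.
  - by move=> x _; exact: sume_ge0.
  - exact: emeasurable_sum.
  apply: leeD => //; rewrite ge0_integral_sum //.
  apply: (@le_trans _ _ (\sum_(w <- enum nb) (eps / 4)%:E)%E).
    apply: lee_sum => w _.
    rewrite (ge0_integral_translate (- phi w) (f := fun x => (bad x)%:E)) //.
    exact/measurable_EFinP.
  rewrite sumEFin lee_fin big_enum sumr_const.
  have c4 : (#|nb| <= 4)%N.
    apply: (@leq_trans #|[pred w | tadj v w]|); last exact: tadj_degree.
    apply: subset_leq_card.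
    by apply/fintype.subsetP => w; rewrite !inE => /andP[].
  have e4 : 0 <= eps / 4 by move: eps0; lra.
  rewrite -[leLHS]mulr_natr.
  apply: (@le_trans _ _ ((eps / 4) * 4%:R)); first by rewrite ler_wpM2l // ler_nat.
  by move: eps0; lra.
have I0 : (0 <= \int[mu]_(x in setT) (local_good s v (upd phi v x))%:E)%E.
  by apply: integral_ge0 => x _; rewrite lee_fin.
case: (\int[mu]_(x in setT) _)%E I0 => [r| |] // _; last by move=> _; rewrite leey.
by rewrite -EFinD !lee_fin; move: eps0; lra.
Qed.

(** Each admissible choice of the outermost height stays in the window, so the hypothesis passes to
    the inner integral and every vertex contributes a factor [eps]. *)
Lemma iint_good (s : seq V) phi : uniq s ->
  (forall w, w \notin s -> `|phi w| <= eps) ->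
  ((eps ^+ size s)%:E <= iint s (fun psi => (good s psi)%:E) phi)%E.
Proof.
have g0 s' psi : (0 <= (good s' psi)%:E)%E by rewrite lee_fin good_ge0.
elim: s phi => [|v s IH] phi /= ; first by rewrite expr0.
move=> /andP[vs us] phis.
apply: (@le_trans _ _ (\int[mu]_(x in setT) ((eps ^+ size s)%:E *
    (local_good (v :: s) v (upd phi v x))%:E))%E).
  rewrite ge0_integralZl //; last 3 first.
  - by apply: (@cmeas_local_good (v :: s) v _ _ (fun x : R => upd phi v x)); apply: measurable_upd.
  - by move=> x _; rewrite lee_fin.
  - by rewrite lee_fin exprn_ge0 // ltW.
  rewrite exprS mulrC EFinM lee_wpmul2l ?lee_fin ?exprn_ge0 ?(ltW eps0) //.
  by apply: integral_local_good; rewrite ?mem_head.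
apply: ge0_le_integral => //.
- by move=> x _; rewrite mule_ge0 // lee_fin ?exprn_ge0 // ltW.
- apply: emeasurable_funM; first exact: measurable_cst.
  by apply: (@cmeas_local_good (v :: s) v _ _ (fun x : R => upd phi v x)); apply: measurable_upd.
- apply: measurable_iint_upd => [psi|]; first by rewrite lee_fin (good_ge0 (v :: s)).
  exact: (@cmeas_good (v :: s)).
move=> x _.
rewrite (eq_iint _ (g := fun psi => ((local_good (v :: s) v psi)%:E * (good s psi)%:E)%E));
  last by move=> psi; rewrite EFinM.
have [Wx|Wx] := boolP (`|x| <= eps); last first.
  rewrite [X in (_ * X)%E](_ : _ = 0%E).
    by rewrite mule0 iint_ge0 // => psi; rewrite mule_ge0 // lee_fin.
  by rewrite /local_good updE eqxx /window (negbTE Wx) mul0r.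
rewrite (iintZ (c := fun psi => (local_good (v :: s) v psi)%:E)) //.
- rewrite muleC lee_wpmul2l ?lee_fin //; apply: IH => // w ws; rewrite updE.
  by case: eqP => // /eqP wv; apply: phis; rewrite inE negb_or wv.
- by move=> psi; rewrite lee_fin.
- exact: cmeas_good.
move=> f g fg; rewrite /local_good fg //; congr (_ * _)%:E.
apply: eq_bigr => w /andP[_]; rewrite inE negb_or => /andP[_ ws].
by rewrite (fg w).
Qed.

Lemma pf_lower (k : bool -> R -> R) (kappa : R) (v0 : V) :
  (forall b, measurable_fun setT (k b)) -> (forall b x, 0 <= k b x) ->
  0 <= kappa -> (forall x, G x -> kappa <= k false x) ->
  ((kappa ^+ #|[pred e : V * V | tadjp e]| * eps ^+ size (others v0))%:E <=
     pf k (@tadjp n) v0 (fun=> false))%E.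
Proof.
move=> mk k0 kap0 kapk; set K := kappa ^+ _.
have K0 : 0 <= K by rewrite exprn_ge0.
apply: (@le_trans _ _
  (K%:E * iint (others v0) (fun psi => (good (others v0) psi)%:E) (fun=> 0%R))%E).
  rewrite EFinM lee_wpmul2l ?lee_fin //; apply: iint_good; first exact: others_uniq.
  by move=> w _; rewrite normr0 ltW.
rewrite -(iintZ (c := fun=> K%:E)) //; last 2 first.
- by move=> psi; rewrite lee_fin good_ge0.
- exact: cmeas_good.
apply: iint_le => [psi|||psi].
- by rewrite mule_ge0 // lee_fin ?good_ge0.
- by apply: cmeas_mule; [move=> d T g mg; exact: measurable_cst|exact: cmeas_good].
- exact: cmeas_weight.
rewrite -EFinM lee_fin.
have [->|g1] := good01 (others v0) psi; first by rewrite mulr0 weight_ge0.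
rewrite g1 mulr1 /K -prodr_const; apply: ler_prod => -[v w] adj; rewrite kap0 /=.
apply: kapk; have [vv0|vv0] := eqVneq v v0; last first.
  by apply: (good_edges g1) => //; rewrite mem_others.
(* An edge that starts at the pin is read from its other end, which is in the list. *)
rewrite -symG opprB; apply: (good_edges g1); last by rewrite tadj_sym.
rewrite mem_others; apply: contraTneq adj => wv0.
by rewrite inE /tadjp /= vv0 wv0 tadj_irr.
Qed.

End LowerBound.

(** * The Peierls estimate *)

Section LexTree.
Context {n : nat}.
Hypothesis hn : (0 < n)%N.
Local Notation V := (tvert n).

Definition ord_dec (i : 'I_n.*2) : 'I_n.*2 :=
  Ordinal (leq_ltn_trans (leq_pred i) (ltn_ord i)).

(** A comb-shaped spanning tree: descend along the line of direction [c] to coordinate 0, then along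
    the spine to the corner [vzero], which is its own parent. *)
Definition lex_parent (c : bool) (v : V) : V :=
  if (0 < dcoord c v)%N then dirv c (ord_dec (dcoord c v)) (dcoord (~~ c) v)
  else dirv c (dcoord c v) (ord_dec (dcoord (~~ c) v)).

Definition lex_rank (v : V) : nat := v.1 + v.2.

Lemma zero_ord_subproof : (0 < n.*2)%N. Proof. by rewrite double_gt0. Qed.
Definition vzero : V := (Ordinal zero_ord_subproof, Ordinal zero_ord_subproof).

Lemma dirvK c (v : V) : dirv c (dcoord c v) (dcoord (~~ c) v) = v.
Proof. by case: c v => -[i j]. Qed.

Lemma lex_dcoord c (v : V) : lex_rank v = (dcoord c v + dcoord (~~ c) v)%N.
Proof. by case: c => //=; rewrite /lex_rank addnC. Qed.

Lemma dcoord_dirv c (i j : 'I_n.*2) : dcoord c (dirv c i j) = i.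
Proof. by case: c. Qed.

Lemma dcoord_dirvN c (i j : 'I_n.*2) : dcoord (~~ c) (dirv c i j) = j.
Proof. by case: c. Qed.

Lemma lex_rank_gt0 c v : v != vzero -> (0 < dcoord c v + dcoord (~~ c) v)%N.
Proof.
move=> v0; rewrite -lex_dcoord lt0n; apply: contra v0.
case: v => i j; rewrite /lex_rank addn_eq0 /= => /andP[/eqP i0 /eqP j0].
by rewrite xpair_eqE -!(inj_eq (@ord_inj _)) /= i0 j0.
Qed.

Lemma lex_rank_parent c v : v != vzero -> (lex_rank (lex_parent c v) < lex_rank v)%N.
Proof.
move=> /(lex_rank_gt0 c); rewrite !(lex_dcoord c) /lex_parent.
by case: ifP => i0; rewrite dcoord_dirv dcoord_dirvN /=; lia.
Qed.

Lemma diff1_ord_dec (i : 'I_n.*2) : (0 < i)%N -> diff1 i (ord_dec i).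
Proof. by move=> i0; apply/(diff1P hn); constructor 2; rewrite /= prednK. Qed.

Lemma tadj_dirv c (i i' j : 'I_n.*2) : diff1 i i' -> tadj (dirv c i j) (dirv c i' j).
Proof. by move=> ii'; case: c; rewrite /tadj /= eqxx ii' ?orbT. Qed.

Lemma tadj_parent c v : v != vzero -> tadj v (lex_parent c v).
Proof.
move=> /(lex_rank_gt0 c) h; rewrite -{1}(dirvK c v) /lex_parent.
case: ifP => i0; first exact/tadj_dirv/diff1_ord_dec.
have j0 : (0 < dcoord (~~ c) v)%N by move: h i0; lia.
have := tadj_dirv (~~ c) (dcoord c v) (diff1_ord_dec j0).
by rewrite /dirv; case: (c).
Qed.

(** The vertices whose tree edge lies on a line of direction [c] filled by [maximal_set_spread]. *)
Definition row_step (c : bool) (r : nat) (v : V) : bool :=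
  (0 < dcoord c v)%N && (odd (dcoord (~~ c) v) == odd r).

(** There are [n] lines of the given parity, and the first [n] steps of each already suffice. *)
Lemma card_row_step c r : (n ^ 2 <= #|row_step c r|)%N.
Proof.
have lt1 (i : 'I_n) : (i.+1 < n.*2)%N by have := ltn_ord i; lia.
have lt2 (i : 'I_n) : (odd r + i.*2 < n.*2)%N by have := ltn_ord i; case: (odd r); lia.
pose f (p : 'I_n * 'I_n) : V := dirv c (Ordinal (lt1 p.1)) (Ordinal (lt2 p.2)).
have finj : injective f.
  move=> [a b] [a' b'] E; have := congr1 (dcoord c) E; have := congr1 (dcoord (~~ c)) E.
  rewrite /f !dcoord_dirv !dcoord_dirvN /= => /(congr1 val) /= h1 /(congr1 val) /= h2.
  by congr pair; apply: ord_inj; lia.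
have -> : (n ^ 2)%N = #|{: 'I_n * 'I_n}| by rewrite card_prod card_ord; lia.
rewrite -(card_codom finj); apply/subset_leq_card/fintype.subsetP => v /codomP[p ->].
rewrite unfold_in /row_step /f dcoord_dirv dcoord_dirvN /= oddD odd_double addbF.
by case: (odd r).
Qed.

Lemma row_step_neq0 c r v : row_step c r v -> v != vzero.
Proof. by move=> /andP[+ _]; apply: contraTneq => ->; case: c. Qed.

End LexTree.

(** * The empty set of marks is a maximizer *)

Section Peierls.
Context {R : realType}.
Local Notation mu := (@lebesgue_measure R).
Variables (u : R -> R) (B delta L J eta : R).
Hypothesis mu_u : measurable_fun setT u.
Hypothesis u0 : forall x, 0 <= u x.
Hypothesis uB : forall x, u x <= B.
Hypothesis symu : forall x, u (- x) = u x.
Hypothesis d01 : 0 < delta < 1.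

Definition bond (b : bool) (x : R) : R :=
  (if b then delta^-1 * (L <= `|x|)%R%:R else 1) * Num.sqrt (u x).

Hypothesis uJ : (\int[mu]_(x in setT) (u x)%:E = J%:E)%E.
Hypothesis ueta : (\int[mu]_(x in setT) (u x * (L <= `|x|)%R%:R)%:E = eta%:E)%E.

Let d0 : 0 < delta. Proof. by case/andP: d01. Qed.
Let dV1 : 1 <= delta^-1. Proof. by rewrite invf_ge1 // ltW //; case/andP: d01. Qed.
Let dV0 : 0 <= delta^-1. Proof. exact: le_trans dV1. Qed.

Lemma measurable_tail : measurable_fun setT (fun x : R => (L <= `|x|)%R%:R : R).
Proof.
apply: measurable_natr_bool; apply: measurable_fun_ler => //.
Qed.

Lemma measurable_bond b : measurable_fun setT (bond b).
Proof.
apply: measurable_funM.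
  case: b => //; apply: measurable_funM => //; exact: measurable_tail.
apply: (measurableT_comp _ mu_u).
by apply: continuous_measurable_fun; exact: sqrt_continuous.
Qed.

Lemma bond_ge0 b x : 0 <= bond b x.
Proof.
by rewrite mulr_ge0 ?sqrtr_ge0 //; case: b; rewrite ?ler01 // mulr_ge0 // ler0n.
Qed.

(** The summand 1 makes the bound at least 1, as [weight_tree_le] requires. *)
Definition bond_bound : R := 1 + delta^-1 * Num.sqrt B.

Lemma bond_bound_ge1 : 1 <= bond_bound.
Proof. by rewrite lerDl mulr_ge0 ?sqrtr_ge0. Qed.

Lemma bond_le b x : bond b x <= bond_bound.
Proof.
have s : Num.sqrt (u x) <= Num.sqrt B by rewrite ler_wsqrtr.
apply: (@le_trans _ _ (delta^-1 * Num.sqrt B)); last by rewrite lerDr.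
apply: ler_pM; rewrite ?sqrtr_ge0 //.
  by case: b; rewrite ?ler01 // mulr_ge0 // ler0n.
by case: b => //; case: (L <= _); rewrite ?mulr1 ?mulr0.
Qed.

Let sqrt_sqr x : Num.sqrt (u x) * Num.sqrt (u x) = u x.
Proof. by rewrite -expr2 sqr_sqrtr. Qed.

Section Torus.
Variable n : nat.
Hypothesis hn : (0 < n)%N.
Local Notation V := (tvert n).

(** The two orientations of a tree edge give two square roots, hence [u], and at most two factors
    [delta^-1]; on [T] the tail indicator is retained. *)
Let h (T : pred V) (v : V) (x : R) : R :=
  delta^-1 ^+ 2 * (u x * (if T v then (L <= `|x|)%R%:R else 1)).
Let cst_h (T : pred V) (v : V) : R := delta^-1 ^+ 2 * (if T v then eta else J).

Lemma pf_bond_le c (T : pred V) (S : pred (V * V)) :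
  (forall v, T v -> v != vzero hn /\ present S (lex_parent c v) v) ->
  (pf bond (@tadjp n) (vzero hn) S <=
    (bond_bound ^+ #|[pred e : V * V | tadjp e]| *
       \prod_(v | v != vzero hn) cst_h T v)%:E)%E.
Proof.
move=> TS; apply: (@pf_tree_le R n (vzero hn) (lex_parent c) (@lex_rank n) _ bond _ S _ (h T)).
- by move=> v; exact: lex_rank_parent.
- exact: measurable_bond.
- exact: bond_bound_ge1.
- by move=> b x; rewrite bond_ge0 bond_le.
- by move=> v v0; rewrite /tadjp /= [X in _ && X]tadj_sym tadj_parent.
- move=> v; apply: measurable_funM => //; apply: measurable_funM => //.
  by case: (T v) => //; exact: measurable_tail.
- by move=> v x; rewrite !mulr_ge0 // ?exprn_ge0 //; case: (T v).
- move=> v; under eq_integral do rewrite EFinM.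
  rewrite ge0_integralZl_EFin //; last 3 first.
  + by move=> x _; rewrite lee_fin mulr_ge0 //; case: (T v).
  + apply/measurable_EFinP; apply: measurable_funM => //.
    by case: (T v) => //; exact: measurable_tail.
  + by rewrite exprn_ge0.
  rewrite /cst_h [RHS]EFinM; congr (_ * _)%E; case: (T v) => //.
  by rewrite -uJ; apply: eq_integral => x _; rewrite mulr1.
move=> v x v0; rewrite /bond symu normrN mulrACA sqrt_sqr mulrC /h [leRHS]mulrCA.
apply: ler_wpM2l => //.
have dV2 : 1 <= delta^-1 ^+ 2 by rewrite exprn_ege1.
have dV12 : delta^-1 <= delta^-1 ^+ 2 by rewrite expr2 ler_peMr.
(* On [T] at least one orientation is marked, which supplies the indicator; elsewhere indicators are
   bounded by 1. *)
have [/TS[_ +]|nTv] := boolP (T v); rewrite /present.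
  by case: (S (v, _)); case: (S (_, v)) => // _; case: (L <= _);
    rewrite ?mulr1 ?mul1r ?mulr0 // -expr2.
by case: (S (v, _)); case: (S (_, v)); case: (L <= _);
  rewrite ?mulr1 ?mul1r ?mulr0 ?mul0r -?expr2 // ?exprn_ge0.
Qed.

Lemma pf_bond_fin v0 S : (pf bond (@tadjp n) v0 S < +oo)%E.
Proof.
rewrite (pf_repin measurable_bond bond_ge0 _ v0 (vzero hn)).
apply: (le_lt_trans (@pf_bond_le true pred0 S _)); last exact: ltry.
by [].
Qed.

Variables (eps kappa : R).
Hypothesis eps01 : 0 < eps <= 1.
Hypothesis kappa01 : 0 < kappa <= 1.
Hypothesis bigG : (\int[mu]_(x in setT)
  ((`|x| <= 2 * eps) && ~~ (kappa <= Num.sqrt (u x)))%:R%:E <= (eps / 4)%:E)%E.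
Hypothesis eta_small : bond_bound ^+ 16 * (1 + delta^-1 ^+ 2 * J) ^+ 4 *
  (delta^-1 ^+ 2 * eta) < kappa ^+ 16 * eps ^+ 4.

Lemma pf_bond_ge v0 :
  (((kappa ^+ 16 * eps ^+ 4) ^+ (n ^ 2))%:E <= pf bond (@tadjp n) v0 (fun=> false))%E.
Proof.
have [k0 k1] := andP kappa01; have [e0 e1] := andP eps01.
apply: le_trans (pf_lower (G := fun x => kappa <= Num.sqrt (u x)) (kappa := kappa)
  hn e0 _ _ bigG v0 measurable_bond bond_ge0 (ltW k0) _); last 3 first.
- apply: measurable_fun_ler => //; apply: (measurableT_comp _ mu_u).
  by apply: continuous_measurable_fun; exact: sqrt_continuous.
- by move=> x; rewrite symu.
- by move=> x; rewrite /bond mul1r.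
(* As [kappa] and [eps] are at most 1, the exponents may grow to [16 * n ^ 2] and [4 * n ^ 2]. *)
rewrite lee_fin exprMn -!exprM; apply: ler_pM; rewrite ?exprn_ge0 ?(ltW k0) ?(ltW e0) //.
  by apply: ler_wiXn2l; rewrite ?card_tadjp ?(ltW k0).
apply: ler_wiXn2l; rewrite ?(ltW e0) //.
rewrite -card_tvert (_ : size _ = #|others v0|) ?max_card //.
exact/esym/card_uniqP/others_uniq.
Qed.

(** Per unit of [n ^ 2] there are at most 16 directed edges, at most 4 vertices and at least one row
    step, which explains the exponents in [eta_small]; its [n ^ 2]-th power separates the two
    bounds. *)
Lemma pf_row_step_lt c r S :
  (forall v, row_step c r v -> present S (lex_parent c v) v) ->
  (pf bond (@tadjp n) (vzero hn) S < pf bond (@tadjp n) (vzero hn) (fun=> false))%E.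
Proof.
move=> TS; apply: lt_le_trans (pf_bond_ge _).
apply: le_lt_trans (pf_bond_le (c := c) (T := row_step c r) _) _.
  by move=> v Tv; split; [exact: row_step_neq0 Tv|exact: TS].
have [k0 k1] := andP kappa01; have [e0 e1] := andP eps01.
set M := bond_bound; pose J' := 1 + delta^-1 ^+ 2 * J; pose eta' := delta^-1 ^+ 2 * eta.
have M1 : 1 <= M by exact: bond_bound_ge1.
have d2 : 0 <= delta^-1 ^+ 2 by rewrite exprn_ge0.
have J0 : 0 <= J by rewrite -lee_fin -uJ; apply: integral_ge0 => x _; rewrite lee_fin.
have eta0 : 0 <= eta.
  by rewrite -lee_fin -ueta; apply: integral_ge0 => x _; rewrite lee_fin mulr_ge0.
have J'1 : 1 <= J' by rewrite lerDl mulr_ge0.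
have eta'0 : 0 <= eta' by rewrite mulr_ge0.
have Q1 : 1 <= M ^+ 16 * J' ^+ 4 by rewrite mulr_ege1 // exprn_ege1.
have D1 : kappa ^+ 16 * eps ^+ 4 <= 1.
  by rewrite mulr_ile1 // ?exprn_ge0 ?exprn_ile1 // ltW.
(* This allows the number of row steps to be replaced by its lower bound [n ^ 2] in the exponent;
   likewise [1 <= J'] allows the other exponent to be raised. *)
have eta'1 : eta' <= 1.
  apply: le_trans D1; apply: le_trans (ltW eta_small).
  by rewrite -[leLHS]mul1r ler_wpM2r.
have n2 : (0 < n ^ 2)%N by rewrite expn_gt0 hn.
have lt2 : (M ^+ 16 * J' ^+ 4 * eta') ^+ (n ^ 2) < (kappa ^+ 16 * eps ^+ 4) ^+ (n ^ 2).
  by rewrite ltrXn2r ?lt0n_neq0 // mulr_ge0 // (le_trans ler01).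
rewrite lte_fin; apply: le_lt_trans lt2.
rewrite [leRHS]exprMn [(M ^+ 16 * _) ^+ _]exprMn -!exprM -mulrA; apply: ler_pM.
- by rewrite exprn_ge0 // (le_trans ler01).
- by rewrite prodr_ge0 // => v _; rewrite /cst_h mulr_ge0 //; case: ifP.
- by apply: ler_weXn2l => //; exact: card_tadjp.
rewrite (bigID (row_step c r)) /= mulrC; apply: ler_pM.
- by rewrite prodr_ge0 // => v _; rewrite /cst_h mulr_ge0 //; case: ifP.
- by rewrite prodr_ge0 // => v _; rewrite /cst_h mulr_ge0 //; case: ifP.
- apply: (@le_trans _ _ (\prod_(v | (v != vzero hn) && ~~ row_step c r v) J')).
    apply: ler_prod => v /andP[_ /negbTE nT].
    by rewrite /cst_h nT mulr_ge0 //= lerDr.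
  rewrite prodr_const; apply: ler_weXn2l => //.
  by rewrite -card_tvert max_card.
rewrite (eq_bigr (fun=> eta')); last by move=> v /andP[_ Tv]; rewrite /cst_h Tv.
rewrite prodr_const; apply: ler_wiXn2l => //.
apply: leq_trans (card_row_step hn c r) _; apply: subset_leq_card.
apply/fintype.subsetP => v Tv; change ((v != vzero hn) && row_step c r v).
by rewrite (row_step_neq0 hn Tv).
Qed.

(** A set beating the empty one yields a maximizer with a marked edge, hence one with filled lines,
    which [pf_row_step_lt] places strictly below the empty set. *)
Lemma pf_bond_max v0 S :
  (pf bond (@tadjp n) v0 S <= pf bond (@tadjp n) v0 (fun=> false))%E.
Proof.
rewrite leNgt; apply/negP => lt0.
have [S1 max1 le1] := exists_maximal_set measurable_bond bond_ge0 S v0.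
have {le1} lt1 : (pf bond (@tadjp n) v0 (fun=> false) < pf bond (@tadjp n) v0 S1)%E.
  exact: lt_le_trans lt0 le1.
have [e /andP[Ee Se]] : exists e, tadjp e && S1 e.
  apply: contrapT => nex; move: lt1.
  rewrite (_ : pf _ _ _ S1 = pf bond (@tadjp n) v0 (fun=> false)) ?ltxx //.
  by apply: eq_pf => e Ee; apply/negbTE/negP => Se; apply: nex; exists e; rewrite Ee Se.
have [S2 [c [r [max2 row2]]]] :=
  maximal_set_spread hn measurable_bond bond_ge0 pf_bond_fin max1 Ee Se.
have /pf_row_step_lt : forall v, row_step c r v -> present S2 (lex_parent c v) v.
  move=> v /andP[i0 /eqP jr]; rewrite -{2}(dirvK c v) /lex_parent i0.
  by apply: row2 => //=; rewrite prednK.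
apply/negP; rewrite -leNgt.
exact: max2.
Qed.

End Torus.
End Peierls.

(** * Choosing the constants from the potential *)

Section Analysis.
Context {R : realType}.
Local Notation mu := (@lebesgue_measure R).

Lemma ae_filter_lebesgue : Filter (nbhs (almost_everywhere mu)).
Proof. exact: ae_filter_ringOfSetsType. Qed.

(** Dominated convergence with [f] as dominating function: almost everywhere the truncated integrand
    is eventually 0. *)
Lemma integral_cut_small (f : R -> R) (c : nat -> R -> bool) (eta : R) :
  measurable_fun setT f -> (forall x, 0 <= f x) ->
  (\int[mu]_(x in setT) (f x)%:E < +oo)%E ->
  (forall j, measurable_fun setT (c j)) ->
  {ae mu, forall x, f x = 0 \/ exists J, forall j, (J <= j)%N -> ~~ c j x} ->
  0 < eta ->
  exists j, (\int[mu]_(x in setT) (f x * (c j x)%:R)%:E < eta%:E)%E.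
Proof.
move=> mf f0 fi mc ae eta0.
pose F j x : \bar R := (f x * (c j x)%:R)%:E.
have mF j : measurable_fun setT (F j).
  by apply/measurable_EFinP; apply: measurable_funM => //; exact: measurable_natr_bool.
have mEf : measurable_fun setT (EFin \o f) by exact/measurable_EFinP.
have intf : mu.-integrable setT (EFin \o f).
  apply/integrableP; split=> //.
  by under eq_integral do rewrite /= ger0_norm //.
have F_cvg : {ae mu, forall x, setT x -> F ^~ x @ \oo --> (cst 0%E x : \bar R)}.
  apply: (@filterS _ _ ae_filter_lebesgue) ae => x [fx0|[J HJ]] _.
    rewrite (_ : F ^~ x = fun=> 0%E); first exact: cvg_cst.
    by apply/funext => j; rewrite /F fx0 mul0r.
  apply: cvg_near_cst; exists J => // j /= Jj.
  by rewrite /F (negbTE (HJ j Jj)) mulr0.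
have F_le : {ae mu, forall x j, setT x -> (`|F j x| <= (EFin \o f) x)%E}.
  apply: aeW => x j _; rewrite /F /= lee_fin ger0_norm ?mulr_ge0 //.
  by case: (c j x); rewrite ?mulr1 ?mulr0.
have [_ _] := @dominated_convergence _ (measurableTypeR R) R mu setT measurableT F
  (cst 0%E) (EFin \o f) mF (measurable_cst 0%E) F_cvg intf F_le.
rewrite integral0 => lim0; apply: contrapT => nex.
have : (eta%:E <= limn (fun j => \int[mu]_(x in setT) F j x))%E.
  apply: lime_ge; first by apply/cvg_ex; exists 0%E.
  by apply: nearW => j; rewrite leNgt; apply/negP => lt; apply: nex; exists j.
by rewrite (cvg_lim _ lim0) // lee_fin leNgt eta0.
Qed.

Section Potential.
Variable U : R -> \bar R.
Hypothesis mU : measurable_fun setT U.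
Variable m : R.
Hypothesis Um : forall x, (m%:E <= U x)%E.

Definition boltzmann (x : R) : R := fine (expeR (- U x)).

Lemma boltzmannE x : expeR (- U x) = (boltzmann x)%:E.
Proof.
rewrite /boltzmann fineK //; have := Um x; case: (U x) => [r||] //=.
Qed.

Lemma boltzmann_ge0 x : 0 <= boltzmann x.
Proof. by rewrite -lee_fin -boltzmannE expeR_ge0. Qed.

Lemma boltzmann_le x : boltzmann x <= expR (- m).
Proof.
by rewrite -lee_fin -boltzmannE -[leRHS]/(expeR (- m%:E)) lee_expeR leeN2.
Qed.

Lemma boltzmann_gt0 x : (U x < +oo)%E -> 0 < boltzmann x.
Proof.
by move=> Ux; rewrite -lte_fin -boltzmannE expeR_gt0 // lteNr.
Qed.

Lemma measurable_boltzmann : measurable_fun setT boltzmann.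
Proof.
have -> : boltzmann = fun x => if (U x < +oo)%E then expR (- fine (U x)) else 0.
  apply/funext => x; rewrite /boltzmann; have := Um x.
  by case: (U x) => [r||] // _; rewrite ?ltry ?ltxx.
apply: measurable_fun_ifT => //.
- exact: measurable_fun_lte.
apply: (measurableT_comp (@measurable_expR R)); apply: measurable_funN.
by apply: (measurableT_comp _ mU); exact: fine_measurable.
Qed.

End Potential.

(** On a compact interval inside the positivity range of [u], the sets where the square root of [u]
    is below [1 / (j + 1)] decrease to the empty set, so some [j] makes their measure small. *)
Lemma exists_thick_set (u : R -> R) (K : R) : measurable_fun setT u ->
  0 < K -> (forall x, `|x| < K -> 0 < u x) ->
  exists eps kappa, [/\ 0 < eps <= 1, 0 < kappa <= 1 &
    (\int[mu]_(x in setT) ((`|x| <= 2 * eps) && ~~ (kappa <= Num.sqrt (u x)))%:R%:E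
      <= (eps / 4)%:E)%E].
Proof.
move=> mes_u K0 u0.
(* The bound [K / 4] keeps the interval of radius [2 * eps] strictly inside radius [K]. *)
pose eps := Num.min 1 (K / 4).
have eps0 : 0 < eps by rewrite lt_min ltr01 divr_gt0.
have eps1 : eps <= 1 by rewrite ge_min lexx.
have epsK : 2 * eps < K.
  have : eps <= K / 4 by rewrite ge_min lexx orbT.
  by lra.
pose f (x : R) : R := (`|x| <= 2 * eps)%R%:R.
pose c (j : nat) (x : R) := ~~ (j.+1%:R^-1 <= Num.sqrt (u x)).
have [||||||j Hj] := @integral_cut_small f c (eps / 4).
- by apply: measurable_natr_bool; exact: measurable_norm_le.
- by move=> x; rewrite ler0n.
- rewrite (_ : (\int[mu]_(x in setT) (f x)%:E)%E =
      (\int[mu]_(x in setT) (\1_(`[- (2 * eps), 2 * eps]%classic) x)%:E)%E).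
    rewrite integral_indic // setIT.
    rewrite -[ltLHS]/(@lebesgue_measure R `[- (2 * eps), 2 * eps]%classic).
    by rewrite lebesgue_measure_itv /=; case: ifP => // _; rewrite -EFinD ltry.
  by apply: eq_integral => x _; rewrite indicE /f mem_setE in_itv /= ler_norml.
- move=> j; apply: measurable_neg; apply: measurable_fun_ler => //.
  apply: (measurableT_comp _ mes_u).
  by apply: continuous_measurable_fun; exact: sqrt_continuous.
- apply: aeW => x; rewrite /f; have [xe|] := boolP (`|x| <= 2 * eps); last by left.
  right; have su : 0 < Num.sqrt (u x) by rewrite sqrtr_gt0 u0 // (le_lt_trans xe).
  exists (Num.bound (Num.sqrt (u x))^-1) => j Jj; rewrite /c negbK.
  rewrite invf_ple ?posrE //.
  have := archi_boundP (ltW (_ : 0 < (Num.sqrt (u x))^-1)); rewrite invr_gt0 => /(_ su) H.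
  by rewrite (le_trans (ltW H)) // ler_nat ltnW.
- by rewrite divr_gt0.
exists eps, j.+1%:R^-1; rewrite eps0 eps1 invr_gt0 ltr0n /= invf_le1 ?ler1n // ; split=> //.
apply: le_trans (ltW Hj); rewrite le_eqVlt; apply/orP; left; apply/eqP.
by apply: eq_integral => x _; rewrite /f /c -natrM mulnb.
Qed.

(** The cutoff tends to infinity when [U] is finite, and otherwise increases to [K] while staying
    strictly below it, which leaves room for the required radius above [L]. *)
Lemma exists_small_tail (u : R -> R) (U : R -> \bar R) (eta : R) :
  measurable_fun setT u -> (forall x, 0 <= u x) ->
  (forall x, U x = +oo%E -> u x = 0) ->
  (\int[mu]_(x in setT) (u x)%:E < +oo)%E ->
  (forall x : R, (U x < +oo)%E) \/
    (exists K : R, 0 < K /\ (forall x : R, `|x| < K -> (U x < +oo)%E) /\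
       (forall x : R, K < `|x| -> U x = +oo%E)) ->
  0 < eta ->
  exists L, [/\ 0 < L, exists K, L < K /\ forall x : R, `|x| < K -> (U x < +oo)%E &
    (\int[mu]_(x in setT) (u x * (L <= `|x|)%R%:R)%:E < eta%:E)%E].
Proof.
move=> mes_u u0 uU iu supp eta0.
pose cut (L : nat -> R) j (x : R) := L j <= `|x|.
have mcut L j : measurable_fun setT (cut L j).
  by apply: measurable_fun_ler => //.
case: supp => [fin|[K [K0 [finK infK]]]].
  have [|j Hj] := integral_cut_small (c := cut (fun j => j.+1%:R)) mes_u u0 iu (mcut _) _ eta0.
    apply: aeW => x; right; exists (Num.bound `|x|) => j Jj.
    rewrite -ltNge; apply: lt_le_trans (archi_boundP (normr_ge0 x)) _.
    by rewrite ler_nat leqW.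
  exists j.+1%:R; split=> //; exists (j.+1%:R + 1); split=> //; first by rewrite ltrDl.
(* The denominator starts at 2 so that the cutoff is positive already for [j = 0]. *)
have [|j Hj] := integral_cut_small (c := cut (fun j => K - K / j.+2%:R)) mes_u u0 iu (mcut _) _ eta0.
  (* Nothing is prescribed for [U] at [K] and [- K]; these two points are discarded as null sets. *)
  have ae1 (a : R) : {ae mu, forall x : R, x <> a}.
    exists [set a]; split; first exact: measurable_set1.
      exact: lebesgue_measure_set1.
    by move=> x /= /contrapT.
  apply: (@filterS2 _ _ ae_filter_lebesgue) (ae1 K) (ae1 (- K)) => x xK xNK.
  have [Kx|xK'|E] := ltgtP K `|x|; first by left; apply/uU/infK.
    right; exists (Num.bound (K / (K - `|x|))) => j Jj.
    rewrite -ltNge ltrBrDl -ltrBrDr ltr_pdivrMr //.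
    rewrite -subr_gt0 in xK'.
    have := archi_boundP (divr_ge0 (ltW K0) (ltW xK')).
    rewrite ltr_pdivrMr // => /lt_le_trans -> //.
    rewrite mulrC ler_wpM2l ?(ltW xK') // ler_nat.
    by rewrite (leq_trans Jj) // ltnW.
  exfalso; case: (lerP 0 x) => x0; move: E.
    by rewrite ger0_norm // => E; apply: xK.
  by rewrite ltr0_norm // => E; apply: xNK; rewrite E opprK.
exists (K - K / j.+2%:R); split=> //.
  by rewrite subr_gt0 ltr_pdivrMr // ltr_pMr // ltr1n.
by exists K; split=> //; rewrite ltrBlDr ltrDl divr_gt0.
Qed.

End Analysis.

(** * The Gibbs density as an edge weight *)

Section GibbsWeight.
Context {R : realType} {n : nat}.
Hypothesis hn : (0 < n)%N.
Local Notation V := (tvert n).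
Variables (U : R -> \bar R) (m : R).
Hypothesis Um : forall x, (m%:E <= U x)%E.
Hypothesis symU : forall x, U x = U (- x).
Local Notation u := (boltzmann U).

Lemma boltzmann_sym x : u (- x) = u x.
Proof. by rewrite /boltzmann -symU. Qed.

Lemma tedges_tadj (e : V * V) : e \in tedges n -> tadjp e.
Proof. by rewrite inE => /andP[]. Qed.

(** The torus has no loops, so each directed edge or its reverse, and never both, is the
    representative in [tedges]. *)
Lemma prod_tadj (f : V * V -> R) : 
  \prod_(e | tadjp e) f e = \prod_(e in tedges n) (f e * f (e.2, e.1)).
Proof.
pose swap (e : V * V) := (e.2, e.1).
have swapK : involutive swap by case.
rewrite (bigID (mem (tedges n))) /= big_split /=; congr (_ * _).
  by apply: eq_bigl => e; case te: (e \in tedges n); rewrite ?andbF // tedges_tadj.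
rewrite (reindex_inj (inv_inj swapK)) /=; apply: eq_bigl => -[v w].
rewrite !inE /tadjp /= tadj_sym; case vw: (tadj v w) => //=.
rewrite -leqNgt leq_eqVlt; case: eqP => [/ord_inj/enum_rank_inj E|] //=.
by move: vw; rewrite E tadj_irr.
Qed.

Lemma gibbs_densE (delta L : R) (phi : V -> R) :
  gibbs_dens U phi = (weight (bond u delta L) (@tadjp n) (fun=> false) phi)%:E.
Proof.
rewrite /weight prod_tadj /gibbs_dens.
rewrite [in RHS](eq_bigr (fun e => u (phi e.1 - phi e.2))); last first.
  move=> e _; rewrite /bond !mul1r /= -(opprB (phi e.1)) boltzmann_sym -expr2.
  by rewrite sqr_sqrtr // (boltzmann_ge0 Um).
(* The sum is carried along as different from [-oo], so that no undefined addition occurs when the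
   exponential is split. *)
suff [] : expeR (- \sum_(e in tedges n) U (phi e.1 - phi e.2)%R)%E =
    (\prod_(e in tedges n) u (phi e.1 - phi e.2))%:E /\
    (-oo < \sum_(e in tedges n) U (phi e.1 - phi e.2)%R)%E by [].
elim/big_rec2: _ => [|e x y _ [IH y0]]; first by rewrite oppe0 expeR0 ltNyr.
have U0 : (-oo < U (phi e.1 - phi e.2)%R)%E := lt_le_trans (ltNyr m) (Um _).
split; last by rewrite lteNye adde_eq_ninfty negb_or -!lteNye U0 y0.
rewrite oppeD ?expeRD ?IH ?(boltzmannE Um) ?EFinM //.
by move: U0 y0; rewrite /adde_def; case: (U _) => [?||] //; case: x {IH} => [?||].
Qed.

(** As [S] lies in [tedges], each of its edges is marked in one orientation only; the resulting
    factors [delta^-1] cancel [delta ^+ #|S|] and leave the indicator of the event. *)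
Lemma gibbs_dens_event (delta L : R) (S : {set V * V}) (phi : V -> R) :
  delta != 0 -> S \subset tedges n ->
  ((if [forall e in S, (L <= `|phi e.1 - phi e.2|)%R] then 1%R else 0%R)%:E *
    gibbs_dens U phi =
   (delta ^+ #|S| * weight (bond u delta L) (@tadjp n) (fun e => e \in S) phi)%:E)%E.
Proof.
move=> d0 /fintype.subsetP SE; rewrite (gibbs_densE delta L) -EFinM; congr EFin.
rewrite /weight /bond !big_split /= [in LHS](eq_bigr (fun=> 1)) // big1_eq mul1r.
rewrite mulrA; congr (_ * _); rewrite -big_mkcondr /=.
rewrite (eq_bigl (fun e => e \in S)); last first.
  by move=> e; case eS: (e \in S); rewrite ?andbF // tedges_tadj // SE.
rewrite big_split /= prodr_const mulrA -exprMn mulfV // expr1n mul1r.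
case: ifPn => [/forall_inP all|].
  by rewrite big1 // => e eS; rewrite all.
rewrite negb_forall_in => /exists_inP[e eS nle].
by rewrite (bigD1 e) //= (negbTE nle) mul0r.
Qed.

End GibbsWeight.

Theorem theorem3p2 (R : realType) (U : R -> \bar R)
  (hU_meas : measurable_fun setT U)
  (hU_sym : forall x : R, U x = U (- x))
  (hU_inf : exists m : R, forall x : R, (m%:E <= U x)%E)
  (hU_int : (0 < \int[@lebesgue_measure R]_(x in setT) expeR (- U x)
               < +oo)%E)
  (hU_supp : (forall x : R, (U x < +oo)%E) \/
             (exists K : R, 0 < K /\
                (forall x : R, `|x| < K -> (U x < +oo)%E) /\
                (forall x : R, K < `|x| -> U x = +oo%E))) :
  forall delta : R, 0 < delta < 1 ->
  exists L : R, 0 < L /\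
    forall (n : nat) (hn : (0 < n)%N), controlled_gradients hn U delta L.
Proof.
move=> delta d01; have [d0 d1] := andP d01.
case: hU_inf => m Um.
pose u := boltzmann U.
have mes_u : measurable_fun setT u by exact: (measurable_boltzmann hU_meas Um).
have u0 x : 0 <= u x by exact: (boltzmann_ge0 Um).
have uB x : u x <= expR (- m) by exact: boltzmann_le.
have symu x : u (- x) = u x by exact: boltzmann_sym.
have iu : (\int[@lebesgue_measure R]_(x in setT) (u x)%:E < +oo)%E.
  case/andP: hU_int => _; under eq_integral do rewrite (boltzmannE Um).
  by [].
have fin_int f : (forall x : R, 0 <= f x) ->
    (\int[@lebesgue_measure R]_(x in setT) (f x)%:E < +oo)%E ->
    (\int[@lebesgue_measure R]_(x in setT) (f x)%:E =
      (fine (\int[@lebesgue_measure R]_(x in setT) (f x)%:E))%:E)%E.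
  move=> f0 fi; rewrite fineK // ge0_fin_numE //.
  by apply: integral_ge0 => x _; rewrite lee_fin.
have uJ := fin_int _ u0 iu; set J := fine _ in uJ.
have [K K0 KU] : exists2 K : R, 0 < K & forall x, `|x| < K -> (U x < +oo)%E.
  by case: hU_supp => [fin|[K [K0 [KU _]]]]; [exists 1|exists K].
have [eps [kappa [eps01 kappa01 bigG]]] :=
  exists_thick_set mes_u K0 (fun x h => boltzmann_gt0 Um (KU x h)).
pose Q := bond_bound (expR (- m)) delta ^+ 16 * (1 + delta^-1 ^+ 2 * J) ^+ 4.
pose D := kappa ^+ 16 * eps ^+ 4.
have J0 : 0 <= J.
  by rewrite -lee_fin -uJ; apply: integral_ge0 => x _; rewrite lee_fin.
have Q0 : 0 < Q.
  have dV : 0 <= delta^-1 by rewrite invr_ge0 ltW.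
  by rewrite mulr_gt0 // exprn_gt0 // ltr_pwDl // mulr_ge0 ?exprn_ge0 ?sqrtr_ge0 //.
have D0 : 0 < D.
  by case/andP: eps01 => ? _; case/andP: kappa01 => ? _; rewrite mulr_gt0 // exprn_gt0.
(* This threshold for the tail integral is the smallness condition [Q * (delta^-1 ^+ 2 * eta) < D]
   solved for [eta]; it does not involve [n]. *)
have theta0 : 0 < delta ^+ 2 * (D / Q) by rewrite mulr_gt0 ?divr_gt0 ?exprn_gt0.
have uy x : U x = +oo%E -> u x = 0 by rewrite /u /boltzmann => ->.
have [L [L0 LK tail]] := exists_small_tail mes_u u0 uy iu hU_supp theta0.
have ueta := fin_int _ (fun x => mulr_ge0 (u0 x) (ler0n _ (L <= `|x|)%R))
  (lt_trans tail (ltry _)).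
set eta := fine _ in ueta.
have eta_small : Q * (delta^-1 ^+ 2 * eta) < D.
  move: tail; rewrite ueta lte_fin => tail.
  rewrite exprVn mulrC -ltr_pdivlMr // mulrC ltr_pdivrMr ?exprn_gt0 //.
  by rewrite mulrC.
exists L; split=> // n hn.
pose k := bond u delta L.
have pf_le S v0 : (pf k (@tadjp n) v0 S <= pf k (@tadjp n) v0 (fun=> false))%E.
  exact: (pf_bond_max mes_u u0 uB symu d01 uJ ueta hn eps01 kappa01 bigG).
have pf_fin S v0 : (pf k (@tadjp n) v0 S < +oo)%E.
  exact: (pf_bond_fin mes_u u0 uB symu d01 uJ ueta hn).
have Z_E : gibbs_Z hn U = pf k (@tadjp n) (torigin hn) (fun=> false).
  by apply: eq_iint => psi; rewrite (gibbs_densE hn Um hU_sym delta L).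
have Z0 : (0 < gibbs_Z hn U)%E.
  rewrite Z_E; apply: lt_le_trans (pf_bond_ge L mes_u symu d01 hn eps01 kappa01 bigG _).
  by rewrite lte_fin exprn_gt0.
split; first by rewrite Z0 Z_E pf_fin.
split=> [//|S SE _].
have num_E : pinned_int hn (fun phi : tvert n -> R =>
    ((if [forall e in S, (L <= `|phi e.1 - phi e.2|)%R] then 1%R else 0%R)%:E *
      gibbs_dens U phi)%E) =
    ((delta ^+ #|S|)%:E * pf k (@tadjp n) (torigin hn) (fun e => e \in S))%E.
  rewrite -(iintZ (c := fun=> (delta ^+ #|S|)%:E)) //.
  - apply: eq_iint => psi.
    by rewrite (gibbs_dens_event hn Um hU_sym L psi (lt0r_neq0 d0) SE) EFinM.
  - by move=> psi; rewrite lee_fin weight_ge0 // => b x; exact: bond_ge0.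
  - by move=> psi; rewrite lee_fin exprn_ge0 // ltW.
  - by apply: cmeas_weight => b; exact: measurable_bond.
(* The probability is [delta ^+ #|S|] times the ratio of the marked to the unmarked partition
   function, and [pf_le] bounds that ratio by 1. *)
rewrite /gibbs_prob num_E Z_E.
have bond0 b x : 0 <= k b x by exact: bond_ge0.
have fin S' : pf k (@tadjp n) (torigin hn) S' \is a fin_num.
  by rewrite ge0_fin_numE ?pf_fin // pf_ge0.
have Zf : 0 < fine (pf k (@tadjp n) (torigin hn) (fun=> false)).
  by rewrite fine_gt0 // -Z_E Z0 Z_E pf_fin.
rewrite fineM //= ler_pdivrMr //; apply: ler_wpM2l; first by rewrite exprn_ge0 // ltW.
by rewrite fine_le.
Qed.
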